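(* Under a fixed clearing frequency, the instantaneous rate hybrid policy performs better than the time policy in terms of average weighted delay rate (AWDR). That is, let $M_H>0$, $T_H>0$ and $T>0$ satisfy $\mathbb{E}[\tau_{M_H}\wedge T_H]=T$. Then $$\mathrm{AWDR}(\tau_{M_H}\wedge T_H)<\mathrm{AWDR}(T).$$
   Context: Let $n\ge 1$, let $B_1,\dots,B_n$ be independent standard Brownian motions (started at $0$), and let $N_i(t)=D_it+\sigma_iB_i(t)$ with $D_i>0$, $\sigma_i>0$ for $i=1,\dots,n$ (cumulative demand of items of type $i$), and let $\omega_i>0$ be the waiting cost per unit of type $i$ per unit time. For a stopping time $\tau$ (clearing cycle) of the natural filtration of $(N_1,\dots,N_n)$ with $0<\mathbb{E}[\tau]<\infty$, the average weighted delay rate is $$\mathrm{AWDR}(\tau)=\frac{\mathbb{E}\left[\sum_{i=1}^n\int_0^\tau\omega_iN_i(u)\,du\right]}{\mathbb{E}[\tau]}.$$ For $M>0$ let $\tau_M=\inf\{t>0:\sum_{i=1}^n\omega_iN_i(t)\ge M\}$. The instantaneous rate hybrid policy (IRHP) with parameters $M,T>0$ has clearing cycle $\tau=\tau_M\wedge T$. The time policy (TP) with parameter $T>0$ has the deterministic clearing cycle $\tau=T$. Policies have the same clearing frequency when their expected cycle lengths are equal. *)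

(* Defs.v *)
From HB Require Import structures.
From mathcomp Require Import all_boot all_order all_algebra.
From mathcomp Require Import all_classical all_reals all_analysis.
Set Implicit Arguments.
Unset Strict Implicit.
Unset Printing Implicit Defensive.
Import Order.TTheory GRing.Theory Num.Theory.
Import numFieldNormedType.Exports.
Local Open Scope classical_set_scope.
Local Open Scope ring_scope.

Section independence.
Context {R : realType} {d : measure_display} {Omega : measurableType d}.
Variable P : probability Omega R.

(* Every subfamily must satisfy the product rule, so that the [G i] may be
   arbitrary set systems (not only sigma-algebras). *)
Definition mutually_independent (I : finType) (G : I -> set (set Omega)) :=
  forall (J : {set I}) (A : I -> set Omega),
    (forall i, i \in J -> G i (A i)) ->
    P (\bigcap_(i in [set` J]) A i) = (\prod_(i in J) P (A i))%E.

Definition independent_RVs (I : finType) (X : I -> Omega -> R) :=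
  mutually_independent (fun i => g_sigma_algebra_preimage (X i)).

(* Processes are families indexed by all of [R]; only the times [t >= 0] are
   ever constrained or used. *)
Definition process_sigma_algebra (X : R -> {RV P >-> R}) : set (set Omega) :=
  <<s \bigcup_(t in `[0, +oo[) g_sigma_algebra_preimage (X t) >>.

Definition independent_processes (I : finType) (X : I -> R -> {RV P >-> R}) :=
  mutually_independent (fun i => process_sigma_algebra (X i)).

(* The second parameter of [normal_prob] is the standard deviation. *)
Definition standard_brownian_motion (B : R -> {RV P >-> R}) :=
  [/\ {ae P, forall w, B 0 w = 0},
      forall (m : nat) (t : R^nat), 0 <= t 0%N -> nondecreasing_seq t ->
        independent_RVs (fun k : 'I_m => B (t k.+1) \- B (t k)),
      forall s t, 0 <= s -> s < t -> forall A, measurable A ->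
        pushforward P (B t \- B s) A = normal_prob 0 (Num.sqrt (t - s)) A
    & {ae P, forall w, {within `[0, +oo[, continuous (fun t => B t w)}}].

End independence.

Section clearing_policies.
Context {R : realType} {d : measure_display} {Omega : measurableType d}.
Variable P : probability Omega R.
Context {n : nat}.

Definition cumulative_demand (D sigma : 'I_n -> R)
    (B : 'I_n -> R -> {RV P >-> R}) (i : 'I_n) (t : R) (w : Omega) : R :=
  D i * t + sigma i * B i t w.

Implicit Types (omega : 'I_n -> R) (N : 'I_n -> R -> Omega -> R).

(* Infimum in the extended reals: it is [+oo] when the level is never
   reached. *)
Definition hitting_time omega N (M : R) (w : Omega) : \bar R :=
  ereal_inf [set t%:E | t in
    [set t : R | 0 < t /\ M <= \sum_(i < n) omega i * N i t w]].

Definition irhp_cycle omega N (M T : R) (w : Omega) : \bar R :=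
  Order.min (hitting_time omega N M w) T%:E.

Definition tp_cycle (T : R) (w : Omega) : \bar R := T%:E.

(* Expectations are written as integrals against [P] because clearing cycles
   and delay costs take values in the extended reals, whereas the notation
   for expectations in the library is for real-valued functions. *)
Definition AWDR omega N (tau : Omega -> \bar R) : \bar R :=
  ((\int[P]_w (\sum_(i < n)
      \int[lebesgue_measure]_(u in [set u : R | (0 <= u)%R /\ u%:E <= tau w])
        (omega i * N i u w)%:E))
   / \int[P]_w tau w)%E.

End clearing_policies.

(* Main.v *)
Require Import Defs.
From mathcomp Require Import all_boot all_order all_algebra.
From mathcomp Require Import all_classical all_reals all_analysis.
From mathcomp Require Import measurable_realfun ring lra.
Import Order.TTheory GRing.Theory Num.Theory.
Import numFieldNormedType.Exports.
Local Open Scope classical_set_scope.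
Local Open Scope ring_scope.

(** Let X be the weighted demand process and tau the cycle of the hybrid policy,
so that E tau = T.  Replacing X by X - M does not change the difference of the
expected delays, which by Fubini is therefore

  int E((1_{u <= T} - 1_{u <= tau}) (X_u - M)) du.

For u > T the integrand is nonnegative because X_u <= M up to time tau.  For
u <= T it is the expectation of X_u - M on the event that X reaches M before u,
and this is positive: after reaching the level, X gains its drift on average.
The last fact only needs independent increments on dyadic grids.  If A_j is the
event that one of the first j times of a grid t sees the level M, and E(Z; A) is
the expectation of Z on the event A, then

  E(X_{t_{j+1}} - M; A_{j+1}) >= E(X_{t_j} - M; A_j) + mu (t_{j+1} - t_j) P(A_j).

Refining the grid, and then letting levels below M increase to M, yields the
event that the continuous path reaches M. *)

(** * Density, first absolute moment, symmetry and tails of the centred normal law *)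

Section normal.
Context {R : realType}.
Local Notation mu := (@lebesgue_measure R).

(** The Radon-Nikodym derivative of [normal_prob] and the density [normal_pdf] have equal integrals
    over measurable sets, hence agree almost everywhere, and change of variables applies. *)
Lemma ge0_integral_normal_prob (s : R) (f : measurableTypeR R -> \bar R) :
  (forall x, 0 <= f x)%E -> measurable_fun setT f ->
  (\int[normal_prob 0 s]_x f x = \int[mu]_x (f x * (normal_pdf 0 s x)%:E))%E.
Proof.
move=> f0 mf.
have dom := @normal_prob_dominates R 0 s.
rewrite -(Radon_Nikodym_SigmaFinite.change_of_variables dom)//.
apply: ae_eq_integral => //.
- apply: emeasurable_funM => //.
  exact: measurable_int (Radon_Nikodym_SigmaFinite.f_integrable dom).
- apply: emeasurable_funM => //; apply/measurable_EFinP.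
  exact: measurable_normal_pdf.
- apply: ae_eqe_mul2l; apply: integral_ae_eq => //.
  + exact: Radon_Nikodym_SigmaFinite.f_integrable.
  + apply/measurable_EFinP; exact: measurable_normal_pdf.
  + by move=> E _ mE; rewrite -Radon_Nikodym_SigmaFinite.f_integral.
Qed.

(** With [y = x^2 / (4 s^2)] the two Gaussian exponentials are [e^(-2y)] and [e^(-y)], so the claim
    is [|x| <= s e^y], which follows from [|x| <= s (1 + y)] by completing the square. Integrating
    the right-hand side, a multiple of a density, bounds the first moment. *)
Lemma normal_pdf_moment_bound (s x : R) : 0 < s ->
  `|x| * normal_pdf 0 s x <=
  Num.sqrt 2 * s * normal_pdf 0 (Num.sqrt 2 * s) x.
Proof.
move=> s0.
have r0 : 0 < Num.sqrt 2 :> R by rewrite sqrtr_gt0.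
have r2 : Num.sqrt 2 ^+ 2 = 2 :> R by rewrite sqr_sqrtr.
rewrite !normal_pdfE ?gt_eqF ?mulr_gt0//.
have -> : normal_peak (Num.sqrt 2 * s) = normal_peak s / Num.sqrt 2.
  rewrite /normal_peak exprMn -mulrnAr -mulrA sqrtrM ?sqr_ge0// sqrtr_sqr.
  by rewrite gtr0_norm// invfM mulrnAr mulrC.
have p0 : 0 < normal_peak s by rewrite normal_peak_gt0// gt_eqF.
rewrite [leLHS]mulrCA.
have -> : Num.sqrt 2 * s * (normal_peak s / Num.sqrt 2 *
    normal_fun 0 (Num.sqrt 2 * s) x) =
    normal_peak s * (s * normal_fun 0 (Num.sqrt 2 * s) x).
  by field; rewrite gt_eqF.
rewrite ler_pM2l// /normal_fun subr0 exprMn r2.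
set y := x ^+ 2 / (s ^+ 2 *+ 4).
have -> : - x ^+ 2 / (s ^+ 2 *+ 2) = - y - y.
  by rewrite /y; field; rewrite gt_eqF.
have -> : - x ^+ 2 / (2 * s ^+ 2 *+ 2) = - y.
  by rewrite /y; field; rewrite gt_eqF.
rewrite expRD mulrA ler_pM2r ?expR_gt0// expRN.
rewrite ler_pdivrMr ?expR_gt0//.
have /le_trans : `|x| <= s * (1 + y).
  have -> : s * (1 + y) = `|x| + s * (`|x| / (2 * s) - 1) ^+ 2.
    have -> : y = `|x| ^+ 2 / (s ^+ 2 *+ 4) by rewrite real_normK ?num_real.
    by field; rewrite gt_eqF.
  by rewrite lerDl mulr_ge0 ?sqr_ge0// ltW.
apply; rewrite ler_pM2l//; exact: expR_ge1Dx.
Qed.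

Lemma normal_prob_abs_moment (s : R) : 0 < s ->
  (\int[normal_prob 0 s]_x (`|x|)%:E <= (Num.sqrt 2 * s)%:E)%E.
Proof.
move=> s0.
have r0 : 0 < Num.sqrt 2 :> R by rewrite sqrtr_gt0.
have mabs : measurable_fun [set: measurableTypeR R] (fun x => (`|x|)%:E).
  by apply/measurable_EFinP; exact: (@normr_measurable R setT).
rewrite ge0_integral_normal_prob//.
apply: (@le_trans _ _ (\int[mu]_x
  ((Num.sqrt 2 * s)%:E * (normal_pdf 0 (Num.sqrt 2 * s) x)%:E)))%E.
  apply: ge0_le_integral => //=.
  - by move=> x _; rewrite mule_ge0// lee_fin normal_pdf_ge0.
  - apply: emeasurable_funM => //.
    apply/measurable_EFinP; exact: measurable_normal_pdf.
  - apply: emeasurable_funM => //.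
    apply/measurable_EFinP; exact: measurable_normal_pdf.
  - move=> x _; rewrite -!EFinM lee_fin.
    exact: normal_pdf_moment_bound.
rewrite ge0_integralZl//=.
- by rewrite integral_normal_pdf mule1.
- apply/measurable_EFinP; exact: measurable_normal_pdf.
- by move=> x _; rewrite lee_fin normal_pdf_ge0.
- by rewrite lee_fin mulr_ge0 ?ltW.
Qed.

Lemma normal_probN (s : R) (A : set R) : s != 0 -> measurable A ->
  normal_prob 0 s ((-%R : R -> R) @^-1` A) = normal_prob 0 s A.
Proof.
move=> s0 mA; rewrite /normal_prob.
have pdfN x : normal_pdf 0 s (- x) = normal_pdf 0 s x :> R.
  by rewrite !normal_pdfE// /normal_fun !subr0 sqrrN.
under eq_integral do rewrite -pdfN.
rewrite -(@ge0_integral_pushforward _ _ (measurableTypeR R) (measurableTypeR R)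
  _ -%R _ mu A (fun x => (normal_pdf 0 s x)%:E))//=.
- apply: eq_measure_integral => B mB _.
  exact: lebesgue_measureN.
- apply/measurable_EFinP/measurable_funTS; exact: measurable_normal_pdf.
- by move=> x _; rewrite lee_fin normal_pdf_ge0.
Qed.

(** Otherwise the positive density would vanish almost everywhere on the half-line, although
    [[c, c + 1]] has measure one. *)
Lemma normal_prob_ge_gt0 (s c : R) : 0 < s ->
  (0 < normal_prob 0 s `[c, +oo[)%E.
Proof.
move=> s0; rewrite lt0e measure_ge0 andbT; apply/eqP => n0.
have : (\int[mu]_(x in `[c, +oo[) `|(normal_pdf 0 s x)%:E| = 0)%E.
  rewrite -[RHS]n0; apply: eq_integral => x _.
  by rewrite gee0_abs// lee_fin normal_pdf_ge0.
move/ae_eq_integral_abs => /(_ _)[]//.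
  apply/measurable_EFinP/measurable_funTS; exact: measurable_normal_pdf.
move=> N [mN N0 sub].
have : (mu `[c, (c + 1)%R] <= mu N)%E.
  apply: le_measure; rewrite ?inE//.
  move=> x; rewrite /= in_itv/= => /andP[cx _]; apply: sub => /=.
  rewrite in_itv/= cx => /(_ isT)/eqP; rewrite eqe gt_eqF//.
  rewrite normal_pdfE ?gt_eqF// mulr_gt0 ?expR_gt0// normal_peak_gt0//.
  by rewrite gt_eqF.
rewrite N0 lebesgue_measure_itv/= lte_fin ltrDl ltr01 -EFinB addrAC subrr.
by rewrite add0r lee_fin ler10.
Qed.

End normal.

(** * Expectation of a symmetric variable, and independence from a generated sigma-algebra *)

Lemma integral_symmetric_law d (T : measurableType d) (R : realType)
    (P : {measure set T -> \bar R}) (Y : T -> R) :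
  measurable_fun setT Y -> P.-integrable setT (EFin \o Y) ->
  (forall A, measurable A -> P (Y @^-1` A) = P (Y @^-1` (-%R @^-1` A))) ->
  (\int[P]_x (Y x)%:E = 0)%E.
Proof.
move=> mY iY symY.
have mNY : measurable_fun setT (fun x => - Y x) by exact: measurableT_comp.
have iNY : P.-integrable setT (EFin \o (fun x => - Y x)).
  by have := integrableN iY.
have mE : measurable_fun [set: R] (@EFin R) by exact: EFin_measurable.
have E : (\int[P]_x (Y x)%:E = \int[P]_x (- Y x)%:E)%E.
  have := integral_pushforward mY mE iY measurableT.
  rewrite preimage_setT => <-.
  have := integral_pushforward mNY mE iNY measurableT.
  rewrite preimage_setT => <-.
  apply: eq_measure_integral => A mA _;  exact: symY.
have fY := integrable_fin_num measurableT iY.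
move: E; under [X in _ = X -> _]eq_integral do rewrite EFinN.
rewrite integralN; last exact: integrable_add_def.
rewrite -(fineK fY) -EFinN => -[] /eqP; rewrite -addr_eq0 -mulr2n mulrn_eq0/=.
by move=> /eqP ->.
Qed.

(** As functions of [F] both sides are finite measures, [P] restricted to [E] and [P] scaled by
    [P E]; they agree on the pi-system [G], so uniqueness of measures applies. *)
Lemma g_sigma_algebra_indep (R : realType) d (T : measurableType d)
    (P : probability T R) (G : set (set T)) (E : set T) :
  G `<=` measurable -> setI_closed G -> G setT -> measurable E ->
  (forall F, G F -> P (F `&` E) = P F * P E)%E ->
  forall F, <<s G >> F -> P (F `&` E) = (P F * P E)%E.
Proof.
move=> Gm GI GT mE GE F sF.
have PE0 : 0 <= fine (P E) by rewrite fine_ge0.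
pose p := NngNum PE0.
have -> : (P F * P E)%E = mscale p P F.
  by rewrite /mscale/= fineK ?fin_num_measure// muleC.
rewrite -[LHS]/(mrestr P mE F).
apply: (g_sigma_algebra_measure_unique G Gm (fun=> setT)) => //.
- by rewrite bigcup_const.
- move=> A GA; rewrite /= /mrestr /mscale/= fineK ?fin_num_measure// muleC.
  exact: GE.
- by move=> _; rewrite /= /mrestr setTI ltey_eq fin_num_measure.
Qed.

(** * Independence of the future increments from the past *)

Section increments.
Context {R : realType} {d : measure_display} {Omega : measurableType d}.
Variable P : probability Omega R.
Variables (n : nat) (B : 'I_n -> R -> {RV P >-> R}).
Hypothesis hB : forall i, standard_brownian_motion (B i).
Hypothesis indB : independent_processes B.
Variable t : R^nat.
Hypothesis t0 : 0 <= t 0%N.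
Hypothesis nd_t : nondecreasing_seq t.

Definition increment (i : 'I_n) (k : nat) : Omega -> R :=
  B i (t k.+1) \- B i (t k).

(** A pi-system generating the sigma-algebra of all increments of index below [j]. The outer
    intersection has the shape to which [mutually_independent] applies. *)
Definition past_cylinders (j : nat) : set (set Omega) :=
  [set F | exists2 S : 'I_n -> nat -> set R, forall i k, measurable (S i k) &
    F = \bigcap_(i in [set` [set: 'I_n]%SET])
          \bigcap_(k in `I_j) (increment i k @^-1` S i k)].

Lemma times_ge0 k : 0 <= t k.
Proof. by apply: le_trans t0 _; exact: nd_t. Qed.

Lemma process_sigma_algebra_value i s : 0 <= s ->
  measurable_fun (setT : set (g_sigma_algebraType
     (\bigcup_(t in `[(0 : R), +oo[) g_sigma_algebra_preimage (B i t))))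
   (B i s : g_sigma_algebraType
     (\bigcup_(t in `[(0 : R), +oo[) g_sigma_algebra_preimage (B i t)) -> R).
Proof.
move=> s0 _ A mA; apply: sub_sigma_algebra; exists s.
  by rewrite /= in_itv/= s0.
by exists A.
Qed.

Lemma process_sigma_algebra_increment i k A : measurable A ->
  process_sigma_algebra (B i) (increment i k @^-1` A).
Proof.
move=> mA.
have := measurable_funB (process_sigma_algebra_value i _ (times_ge0 k.+1))
  (process_sigma_algebra_value i _ (times_ge0 k)).
by move=> /(_ measurableT A mA); rewrite setTI.
Qed.

Lemma process_sigma_algebraI i (A C : set Omega) :
  process_sigma_algebra (B i) A -> process_sigma_algebra (B i) C ->
  process_sigma_algebra (B i) (A `&` C).
Proof.
exact: (@measurableI _ (g_sigma_algebraType
     (\bigcup_(t in `[(0 : R), +oo[) g_sigma_algebra_preimage (B i t)))).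
Qed.

Lemma process_sigma_algebra_cylinder i j (S : nat -> set R) :
  (forall k, measurable (S k)) ->
  process_sigma_algebra (B i) (\bigcap_(k in `I_j) (increment i k @^-1` S k)).
Proof.
move=> mS; apply: (@fin_bigcap_measurable _ (g_sigma_algebraType
     (\bigcup_(t in `[(0 : R), +oo[) g_sigma_algebra_preimage (B i t)))) => //.
by move=> k _; exact: process_sigma_algebra_increment.
Qed.

Lemma increments_indep i m (S : nat -> set R) : (forall k, measurable (S k)) ->
  P (\bigcap_(k in `I_m) (increment i k @^-1` S k)) =
  (\prod_(k < m) P (increment i k @^-1` S k))%E.
Proof.
move=> mS; have [_ /(_ m t t0 nd_t) ind _ _] := hB i.
have := ind [set: 'I_m]%SET (fun k => increment i k @^-1` S k).
under eq_bigl do rewrite inE.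
move=> <-; last by move=> k _; exists (S k); rewrite ?setTI.
congr (P _); apply/seteqP; split => w h k /= km.
  by apply: h; exact: ltn_ord.
by apply: (h (Ordinal km)); rewrite /= inE.
Qed.

Lemma measurable_increment i k : measurable_fun setT (increment i k).
Proof. exact: measurable_funB. Qed.

(** Independence of the processes factors the event over [i]; independence of the increments of
    [B i0] then splits the single factor that contains the new event. *)
Lemma past_cylinders_indep j i0 A F : measurable A -> past_cylinders j F ->
  P (F `&` increment i0 j @^-1` A) = (P F * P (increment i0 j @^-1` A))%E.
Proof.
move=> mA [S mS ->].
set C := fun i => \bigcap_(k in `I_j) (increment i k @^-1` S i k).
set E := increment i0 j @^-1` A.
(* The event [E] is absorbed into the cylinder of its own process, so that each [C' i] lies in the
   sigma-algebra of [B i]. *)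
pose C' i := if i == i0 then C i `&` E else C i.
have -> : \bigcap_(i in [set` [set: 'I_n]%SET]) C i `&` E =
    \bigcap_(i in [set` [set: 'I_n]%SET]) C' i.
  apply/seteqP; split => [w [h Ew] i _|w h].
    by rewrite /C'; case: eqP => _; [split|]; try apply: h; rewrite /= ?inE.
  split; last first.
    by have := h i0; rewrite /C' eqxx /= inE => /(_ isT)[].
  by move=> i iT; have := h i iT; rewrite /C'; case: eqP => _ // [].
have sC i : process_sigma_algebra (B i) (C i).
  exact: process_sigma_algebra_cylinder.
rewrite indB; last first.
  move=> i _; rewrite /C'; case: eqP => [->|_//].
  apply: process_sigma_algebraI => //.
  exact: process_sigma_algebra_increment.
rewrite indB//.
rewrite (bigD1 i0) ?inE//= [in RHS](bigD1 i0) ?inE//=.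
rewrite {1}/C' eqxx.
have -> : P (C i0 `&` E) = (P (C i0) * P E)%E.
  pose S' k := if k == j then A else S i0 k.
  have mS' k : measurable (S' k) by rewrite /S'; case: eqP.
  have -> : C i0 `&` E = \bigcap_(k in `I_j.+1) (increment i0 k @^-1` S' k).
    apply/seteqP; split => [w [h Ew] k /=|w h].
      rewrite ltnS leq_eqVlt /S'; case: eqP => [->//|_ /= kj].
      exact: h.
    split => [k /= kj|].
      by have := h k; rewrite /= /S' ltn_eqF// ltnS (ltnW kj) => /(_ isT).
    by have := h j; rewrite /= /S' eqxx ltnSn => /(_ isT).
  rewrite increments_indep// big_ord_recr/= /S' eqxx increments_indep//.
  congr (_ * _)%E; apply: eq_bigr => k _; rewrite ltn_eqF//.
rewrite muleAC; congr (_ * _ * _)%E.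
by apply: eq_bigr => i; rewrite /C' => /andP[_ /negPf ->].
Qed.

Lemma past_cylinders_measurable j : past_cylinders j `<=` measurable.
Proof.
move=> _ [S mS ->]; apply: fin_bigcap_measurable => // i _.
apply: fin_bigcap_measurable => // k _.
by rewrite -[_ @^-1` _]setTI; exact: measurable_increment.
Qed.

Lemma past_cylindersI j : setI_closed (past_cylinders j).
Proof.
move=> _ _ [S mS ->] [S' mS' ->].
exists (fun i k => S i k `&` S' i k); first by move=> i k; exact: measurableI.
apply/seteqP; split => [w [h h'] i iT k kj|w h].
  by split; [exact: h|exact: h'].
by split => i iT k kj; have [] := h i iT k kj.
Qed.

Lemma past_cylinders_setT j : past_cylinders j setT.
Proof.
exists (fun _ _ => setT) => //.
by apply/seteqP; split.
Qed.

Lemma past_indep j i A F : measurable A -> <<s past_cylinders j >> F ->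
  P (F `&` increment i j @^-1` A) = (P F * P (increment i j @^-1` A))%E.
Proof.
move=> mA; apply: g_sigma_algebra_indep.
- exact: past_cylinders_measurable.
- exact: past_cylindersI.
- exact: past_cylinders_setT.
- by rewrite -[_ @^-1` _]setTI; exact: measurable_increment.
- by move=> G; exact: past_cylinders_indep.
Qed.

End increments.

(** * Moments of Brownian increments and their mean on an independent event *)

Section brownian_increment.
Context {R : realType} {d : measure_display} {Omega : measurableType d}.
Variables (P : probability Omega R) (B : R -> {RV P >-> R}).
Hypothesis hB : standard_brownian_motion B.

Lemma measurable_brownian_increment s t :
  measurable_fun setT (B t \- B s : Omega -> R).
Proof. exact: measurable_funB. Qed.

Lemma brownian_increment_law s t A : 0 <= s -> s < t -> measurable A ->
  P ((B t \- B s) @^-1` A) = normal_prob 0 (Num.sqrt (t - s)) A.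
Proof. by move=> s0 st mA; have [_ _ /(_ s t s0 st A mA)] := hB. Qed.

Lemma brownian_increment_moment s t : 0 <= s -> s <= t ->
  (\int[P]_w (`|B t w - B s w|)%:E <= (Num.sqrt 2 * Num.sqrt (t - s))%:E)%E.
Proof.
(* The normal law of an increment is given for [s < t] only; when [s = t] both sides are zero. *)
move=> s0; rewrite le_eqVlt => /predU1P[->|st].
  rewrite subrr sqrtr0 mulr0 integral0_eq// => w _.
  by rewrite subrr normr0.
have mabs : measurable_fun [set: measurableTypeR R] (fun x => (`|x|)%:E).
  by apply/measurable_EFinP; exact: (@normr_measurable R setT).
have mZ : measurable_fun setT (B t \- B s : Omega -> measurableTypeR R).
  exact: measurable_brownian_increment.
have /esym := ge0_integral_pushforward mZ P
  measurableT mabs (fun x _ => normr_ge0 x).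
rewrite preimage_setT /= => ->.
apply: le_trans (normal_prob_abs_moment (Num.sqrt (t - s)) _); last first.
  by rewrite sqrtr_gt0 subr_gt0.
rewrite le_eqVlt; apply/orP; left; apply/eqP.
by apply: eq_measure_integral => A mA _; exact: brownian_increment_law.
Qed.

Lemma integrable_brownian_increment s t : 0 <= s -> s <= t ->
  P.-integrable setT (EFin \o (B t \- B s)).
Proof.
move=> s0 st; apply/integrableP; split.
  apply/measurable_EFinP; exact: measurable_brownian_increment.
by apply: le_lt_trans (brownian_increment_moment _ _ s0 st) _; rewrite ltry.
Qed.

(* The variable equal to the increment on [F] and to [0] elsewhere has a
symmetric law. *)
Lemma integral_brownian_increment_indep s t F : 0 <= s -> s < t ->
  measurable F ->
  (forall A, measurable A ->
    (P (F `&` ((B t \- B s)%R @^-1` A)) = P F * P ((B t \- B s)%R @^-1` A))%E) ->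
  \int[P]_(w in F) (B t w - B s w) = 0.
Proof.
move=> s0 st mF indF.
set Z : Omega -> R := B t \- B s.
rewrite /Rintegral integral_mkcond.
have mZ : measurable_fun setT Z by exact: measurable_brownian_increment.
have := @integral_symmetric_law _ _ _ P (Z \_ F).
rewrite (_ : (\int[P]_x ((Z \_ F) x)%:E)%E =
  (\int[P]_x ((fun w => (B t w - B s w)%:E) \_ F) x)%E); last first.
  by apply: eq_integral => w _; rewrite !patchE; case: ifP.
have mZF : measurable_fun setT (Z \_ F).
  by apply/(measurable_restrictT _ mF).1; exact: measurable_funTS.
move=> ->//.
  rewrite -restrict_EFin; apply/integrable_restrict => //.
  apply: integrableS (integrable_brownian_increment _ _ s0 (ltW st)) => //.
  exact: measurableI.
(* On [F] independence gives the normal law with weight [P F]; off [F] there is an atom at 0. Both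
   parts are invariant under reflection. *)
have law A : measurable A ->
    P ((Z \_ F) @^-1` A) = (P F * normal_prob 0 (Num.sqrt (t - s)) A +
      P (~` F `&` [set _ | A 0%R]))%E.
  move=> mA; rewrite -brownian_increment_law// -indF// -measureU//; last 3 first.
  - by apply: measurableI => //; rewrite -[_ @^-1` _]setTI; exact: mZ.
  - apply: measurableI; first exact: measurableC.
    have [A0|A0] := pselect (A 0).
      by rewrite (_ : [set _ | _] = setT)//; apply/seteqP; split.
    by rewrite (_ : [set _ | _] = set0)//; apply/seteqP; split.
  - by apply/seteqP; split => // w /= [[? _] []].
  congr (P _); apply/seteqP; split => w /=; rewrite patchE.
    by case: ifPn; rewrite ?inE ?notin_setE => ? ?; [left|right].
  by move=> [[Fw]|[Fw]]; [rewrite mem_set|rewrite memNset].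
move=> A mA; apply: etrans (law A mA) _; apply/esym.
have mNA : measurable (-%R @^-1` A : set R).
  by rewrite -[_ @^-1` _]setTI; exact: (@oppr_measurable R setT).
apply: etrans (law _ mNA) _.
by rewrite normal_probN ?gt_eqF ?sqrtr_gt0 ?subr_gt0//= oppr0.
Qed.

End brownian_increment.

(** * Passage over a level on a grid and in continuous time *)

Section drifted_process.
Context {R : realType} {d : measure_display} {Omega : measurableType d}.
Variable P : probability Omega R.
Variables (n : nat) (B : 'I_n -> R -> {RV P >-> R}).
Hypothesis hB : forall i, standard_brownian_motion (B i).
Hypothesis indB : independent_processes B.
Variables (mu : R) (c : 'I_n -> R).
Hypothesis mu_ge0 : 0 <= mu.

(** The initial values are subtracted because [B i 0] vanishes only almost surely; this way every
    path starts at 0. *)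
Definition drifted (s : R) (w : Omega) : R :=
  mu * s + \sum_(i < n) c i * (B i s w - B i 0 w).

Lemma measurable_drifted s : measurable_fun setT (drifted s).
Proof.
apply: measurable_funD => //; apply: measurable_sum => i.
by apply: measurable_funM => //; exact: measurable_funB.
Qed.

Lemma integrable_drifted s : 0 <= s -> P.-integrable setT (EFin \o drifted s).
Proof.
move=> s0; apply: (eq_integrable measurableT (cst (mu * s)%:E \+
  (fun w => \sum_(i < n) ((c i)%:E * (B i s w - B i 0 w)%:E)))%E).
  by move=> w _ /=; rewrite /drifted EFinD -sumEFin.
apply: integrableD => //; first exact: finite_measure_integrable_cst.
apply: integrable_sum => // i _; apply: integrableZl => //.
exact: integrable_brownian_increment.
Qed.

Lemma integrable_drifted_sub s L F : 0 <= s -> measurable F ->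
  P.-integrable F (EFin \o (fun w => drifted s w - L)).
Proof.
move=> s0 mF; apply: (@integrableS _ _ _ _ setT) => //.
apply: (eq_integrable measurableT (EFin \o drifted s \- cst L%:E)%E) => //.
apply: integrableB => //; first exact: integrable_drifted.
exact: finite_measure_integrable_cst.
Qed.

(** The bound increases with [s], hence is uniform on bounded time intervals, as needed for
    Fubini. *)
Lemma drifted_moment s : 0 <= s ->
  (\int[P]_w `|(drifted s w)%:E| <=
   (mu * s + \sum_(i < n) `|c i| * (Num.sqrt 2 * Num.sqrt s))%:E)%E.
Proof.
move=> s0.
have mabs i : measurable_fun setT
    (fun w => `|c i|%:E * (`|B i s w - B i 0 w|)%:E)%E.
  apply: emeasurable_funM => //; apply/measurable_EFinP.
  by apply: measurableT_comp => //; exact: measurable_funB.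
apply: (@le_trans _ _ (\int[P]_w ((mu * s)%:E +
    \sum_(i < n) `|c i|%:E * (`|B i s w - B i 0 w|)%:E))%E).
  apply: ge0_le_integral => //.
  - by apply: measurableT_comp => //; apply/measurable_EFinP;
      exact: measurable_drifted.
  - apply: emeasurable_funD => //; exact: emeasurable_sum.
  - move=> w _; rewrite abse_EFin.
    under eq_bigr do rewrite -EFinM.
    rewrite sumEFin -EFinD lee_fin (le_trans (ler_normD _ _))//.
    rewrite ger0_norm ?mulr_ge0// lerD2l.
    apply: le_trans (ler_norm_sum _ _ _) _.
    by apply: ler_sum => i _; rewrite normrM.
rewrite ge0_integralD//=; last 3 first.
- by move=> w _; rewrite lee_fin mulr_ge0.
- by move=> w _; apply: sume_ge0 => i _; rewrite mule_ge0.
- exact: emeasurable_sum.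
rewrite integral_cst//= probability_setT mule1 EFinD leeD2l//.
rewrite ge0_integral_sum//.
rewrite -sumEFin; apply: lee_sum => i _.
rewrite ge0_integralZl//; last first.
  apply/measurable_EFinP.
  by apply: measurableT_comp => //; exact: measurable_funB.
rewrite EFinM lee_wpmul2l//.
by apply: le_trans (brownian_increment_moment _ _ _ _ _ _ _) _; rewrite ?subr0.
Qed.

Lemma measurable_drifted_level s M : measurable [set w | M <= drifted s w].
Proof.
rewrite (_ : [set w | _] = drifted s @^-1` `[M, +oo[); last first.
  by apply/seteqP; split => w /=; rewrite in_itv/= andbT.
by rewrite -[_ @^-1` _]setTI; exact: measurable_drifted.
Qed.

Section discrete_passage.
Variable t : R^nat.
Hypothesis t0 : t 0%N = 0.
Hypothesis inc_t : forall k, t k < t k.+1.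

Let nd_t : nondecreasing_seq t.
Proof. by apply/nondecreasing_seqP => k; exact/ltW. Qed.

Let t_ge0' k : 0 <= t k.
Proof. by rewrite -t0; exact: nd_t. Qed.

Definition passage (L : R) (j : nat) : set Omega :=
  \bigcup_(k in `I_j.+1) [set w | L <= drifted (t k) w].

Lemma drifted_increments k w : drifted (t k) w =
  mu * t k + \sum_(i < n) c i * \sum_(l < k) increment P n B t i l w.
Proof.
congr (_ + _); apply: eq_bigr => i _; congr (_ * _).
rewrite -(big_mkord xpredT (fun l => increment P n B t i l w)).
by rewrite telescope_sumr// t0.
Qed.

(** Since [t 0 = 0], the values at times up to [t j] are functions of the increments of index below
    [j]. *)
Lemma passage_past L j : <<s past_cylinders P n B t j >> (passage L j).
Proof.
apply: (@fin_bigcup_measurable _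
  (g_sigma_algebraType (past_cylinders P n B t j))) => // k /= kj.
have mincr i l : (l < j)%N -> @measurable_fun _ _
    (g_sigma_algebraType (past_cylinders P n B t j)) R setT
    (increment P n B t i l).
  move=> lj _ A mA; rewrite setTI; apply: sub_sigma_algebra.
  exists (fun i' l' => if (i' == i) && (l' == l) then A else setT).
    by move=> i' l'; case: ifP.
  apply/seteqP; split => [w Aw i' _ l' _|w h].
    by case: ifPn => // /andP[/eqP -> /eqP ->].
  by have := h i; rewrite /= inE => /(_ isT l lj); rewrite /= !eqxx.
rewrite (_ : [set w | _] = (fun w => mu * t k + \sum_(i < n) c i *
    \sum_(l < k) increment P n B t i l w) @^-1` `[L, +oo[); last first.
  by apply/seteqP; split => w /=; rewrite in_itv/= andbT drifted_increments.
rewrite -[X in measurable X]setTI.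
suff mf : @measurable_fun _ _
    (g_sigma_algebraType (past_cylinders P n B t j)) R setT
    (fun w => mu * t k + \sum_(i < n) c i *
      \sum_(l < k) increment P n B t i l w) by exact: mf.
apply: measurable_funD => //; apply: measurable_sum => i.
apply: measurable_funM => //; apply: measurable_sum => l.
by apply: mincr; apply: leq_trans (ltn_ord l) _.
Qed.

Lemma measurable_passage L j : measurable (passage L j).
Proof.
apply: fin_bigcup_measurable => // k _.
exact: measurable_drifted_level.
Qed.

Lemma subset_passage L j k : (j <= k)%N -> passage L j `<=` passage L k.
Proof. by move=> jk w [l lj Lw]; exists l => //; exact: leq_trans lj _. Qed.

(** The event depends on the past of [t j], so the Brownian part of the next increment has mean zero
    on it and only the drift remains. *)
Lemma integral_drifted_passage_step L j :
  \int[P]_(w in passage L j) (drifted (t j.+1) w - drifted (t j) w) =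
  mu * (t j.+1 - t j) * fine (P (passage L j)).
Proof.
set F := passage L j.
have mF : measurable F by exact: measurable_passage.
have iB i : P.-integrable F (EFin \o increment P n B t i j).
  apply: (@integrableS _ _ _ _ setT) => //.
  by apply: integrable_brownian_increment => //; exact/ltW.
have -> : \int[P]_(w in F) (drifted (t j.+1) w - drifted (t j) w) =
    \int[P]_(w in F) (mu * (t j.+1 - t j) +
      \sum_(i < n) c i * increment P n B t i j w).
  apply: eq_Rintegral => w _; rewrite /drifted opprD addrACA -mulrBr -sumrB.
  congr (_ + _); apply: eq_bigr => i _; rewrite /increment/=.
  by rewrite -mulrBr; congr (_ * _); ring.
have iS : P.-integrable F
    (fun w => \sum_(i < n) ((c i)%:E * (increment P n B t i j w)%:E))%E.
  by apply: integrable_sum => // i _; apply: integrableZl => //; exact: iB.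
rewrite RintegralD//; last 2 first.
- exact: finite_measure_integrable_cst.
- apply: eq_integrable iS => // w _ /=.
  by rewrite -sumEFin; apply: eq_bigr => i _; rewrite EFinM.
rewrite Rintegral_cst// [X in _ + X](_ : _ = 0) ?addr0//.
rewrite /Rintegral.
under eq_integral => w _.
  rewrite -sumEFin; under eq_bigr do rewrite EFinM; over.
rewrite integral_sum//; last by move=> i; apply: integrableZl => //; exact: iB.
rewrite big1// => i _; rewrite integralZl//; last exact: iB.
rewrite -(fineK (integrable_fin_num mF (iB i))).
rewrite -/(Rintegral P F (increment P n B t i j)).
rewrite (_ : Rintegral _ _ _ = 0) ?mule0//.
apply: integral_brownian_increment_indep => // A mA.
have t00 : 0 <= t 0%N by rewrite t0.
exact: (past_indep P n B hB indB t t00 nd_t j i A _ mA (passage_past L j)).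
Qed.

(** The one-step inequality is summed from index [l] on. From there each passage event contains
    [L <= drifted (t l)], which gives a lower bound that depends on the grid only through [t l] and
    [t j]. *)
Lemma integral_drifted_passage L l j : (l <= j)%N ->
  mu * (t j - t l) * fine (P [set w | L <= drifted (t l) w]) <=
  \int[P]_(w in passage L j) (drifted (t j) w - L).
Proof.
have base : 0 <= \int[P]_(w in passage L 0) (drifted (t 0%N) w - L).
  apply: Rintegral_ge0 => w [k]; rewrite /= ltnS leqn0 => /eqP -> /=.
  by rewrite subr_ge0.
have step k : \int[P]_(w in passage L k) (drifted (t k) w - L) +
    mu * (t k.+1 - t k) * fine (P (passage L k)) <=
    \int[P]_(w in passage L k.+1) (drifted (t k.+1) w - L).
  have mF := measurable_passage L k.
  have mD : measurable (passage L k.+1 `\` passage L k).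
    by apply: measurableD => //; exact: measurable_passage.
  have E : passage L k.+1 =
      passage L k `|` (passage L k.+1 `\` passage L k).
    by rewrite setDUK//; exact: subset_passage.
  rewrite [in leRHS]E Rintegral_setU//; last 2 first.
  - by rewrite -E; apply: integrable_drifted_sub => //; exact: measurable_passage.
  - by apply/disj_setPS => w [? []].
  rewrite -integral_drifted_passage_step -RintegralD//=; last 2 first.
  - exact: integrable_drifted_sub.
  - apply: (eq_integrable mF ((EFin \o (fun w => drifted (t k.+1) w - L)%R) \-
      (EFin \o (fun w => drifted (t k) w - L)%R))%E).
      by move=> w _ /=; rewrite -EFinB; congr (_%:E); ring.
    by apply: integrableB => //; exact: integrable_drifted_sub.
  rewrite -[leLHS]addr0; apply: lerD.
    rewrite le_eqVlt; apply/orP; left; apply/eqP; apply: eq_Rintegral => w _.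
    by ring.
  (* A path in the new event but not in the old one is above [L] exactly at index [k.+1], so the
     integrand is nonnegative there. *)
  apply: Rintegral_ge0 => w [[i /= ij Lw] nw].
  have -> : k.+1 = i.
    apply/eqP; rewrite eq_sym eqn_leq -ltnS ij /= ltnNge; apply/negP => ik.
    by apply: nw; exists i.
  by rewrite subr_ge0.
have ge0 k : 0 <= \int[P]_(w in passage L k) (drifted (t k) w - L).
  elim: k => // k IH; apply: le_trans (step k); rewrite addr_ge0// !mulr_ge0//.
    by rewrite subr_ge0 ltW.
  exact: fine_ge0.
elim: j => [|j IH].
  by rewrite leqn0 => /eqP ->; rewrite subrr mulr0 mul0r.
rewrite leq_eqVlt => /predU1P[->|]; first by rewrite subrr mulr0 mul0r.
rewrite ltnS => lj; apply: le_trans (step j).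
have -> : t j.+1 - t l = (t j - t l) + (t j.+1 - t j) by ring.
rewrite mulrDr mulrDl lerD ?IH//.
rewrite ler_wpM2l ?mulr_ge0 ?subr_ge0 ?(ltW (inc_t j))//.
apply: fine_le; rewrite ?fin_num_measure//.
- exact: measurable_drifted_level.
- exact: measurable_passage.
apply: le_measure; rewrite ?inE.
- exact: measurable_drifted_level.
- exact: measurable_passage.
- by move=> w Lw; exists l.
Qed.

End discrete_passage.
End drifted_process.

(** * Limits of integrals over converging events *)

Lemma cvg_Rintegral_sets (R : realType) d (T : measurableType d)
    (mu : {measure set T -> \bar R}) (f : T -> R) (F_ : (set T)^nat) (F : set T) :
  mu.-integrable setT (EFin \o f) -> (forall k, measurable (F_ k)) ->
  measurable F -> (forall x, \forall k \near \oo, F_ k x <-> F x) ->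
  \int[mu]_(x in F_ k) f x @[k --> \oo] --> \int[mu]_(x in F) f x.
Proof.
move=> intf mF_ mF F_F.
have mf : measurable_fun setT (EFin \o f) by exact: measurable_int intf.
have intfF G : measurable G -> mu.-integrable setT ((EFin \o f) \_ G).
  move=> mG; apply/integrable_restrict => //.
  by apply: integrableS intf => //; exact: measurableI.
(* At each point membership is eventually constant, so dominated convergence applies with [|f|] as
   the bound. *)
have near_patch : {ae mu, forall x, setT x ->
    ((EFin \o f) \_ (F_ k)) x @[k --> \oo] --> ((EFin \o f) \_ F) x}.
  apply: aeW => x _; apply: cvg_near_cst.
  apply: filterS (F_F x) => k Fk.
  rewrite !patchE; case: ifPn => [/set_mem/Fk Fx|/negP nFx].
    by rewrite mem_set.
  by rewrite memNset// => /Fk/mem_set.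
have dominated : {ae mu, forall x k, setT x ->
    (`|((EFin \o f) \_ (F_ k)) x| <= (abse \o (EFin \o f)) x)%E}.
  apply: aeW => x k _; rewrite patchE; case: ifPn => // _.
  by rewrite abse0 abse_ge0.
have [_ _] := dominated_convergence measurableT
  (fun k => measurable_int _ (intfF _ (mF_ k)))
  (measurable_int _ (intfF _ mF)) near_patch (integrable_abse intf) dominated.
rewrite -integral_mkcond -(fineK (integrable_fin_num mF _)); last first.
  exact: integrableS intf.
move=> /fine_cvg; rewrite /Rintegral.
by under eq_cvg do rewrite /= -integral_mkcond.
Qed.

(** The error [e] leaves room for approximating events that belong to a slightly lower level than
    the one in the integrand. *)
Lemma ge_Rintegral_sets (R : realType) d (T : measurableType d)
    (mu : {measure set T -> \bar R}) (f : T -> R) (F_ : (set T)^nat) (F : set T)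
    (c : R) (e : R^nat) :
  mu.-integrable setT (EFin \o f) -> (forall k, measurable (F_ k)) ->
  measurable F -> (forall x, \forall k \near \oo, F_ k x <-> F x) ->
  e @ \oo --> 0 ->
  (forall k, c - e k <= \int[mu]_(x in F_ k) f x) ->
  c <= \int[mu]_(x in F) f x.
Proof.
move=> intf mF_ mF F_F e0 ce.
have := cvg_Rintegral_sets _ _ _ _ _ _ _ intf mF_ mF F_F.
move=> /cvg_lim <-//.
have <- : limn (fun k => c - e k) = c.
  by apply/cvg_lim => //; rewrite -[X in _ --> X]subr0; apply: cvgB => //;
    exact: cvg_cst.
apply: ler_lim; last exact: nearW.
  by apply/cvg_ex; exists (c - 0); apply: cvgB => //; exact: cvg_cst.
apply/cvg_ex; eexists; exact: cvg_Rintegral_sets intf mF_ mF F_F.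
Qed.

(** * From dyadic grids to the passage of a continuous path *)

Section continuous_passage.
Context {R : realType} {d : measure_display} {Omega : measurableType d}.
Variable P : probability Omega R.
Variables (n : nat) (B : 'I_n -> R -> {RV P >-> R}).
Hypothesis hB : forall i, standard_brownian_motion (B i).
Hypothesis indB : independent_processes B.
Variables (mu : R) (c : 'I_n -> R).
Hypothesis mu_ge0 : 0 <= mu.
Variable u : R.
Hypothesis u_gt0 : 0 < u.

Local Notation X := (drifted P n B mu c).

(** The exponent [m.+1] makes the midpoint [u / 2] a grid point for every [m], with index
    [2 ^ m]. *)
Definition dyadic_time (m k : nat) : R := k%:R * (u / 2 ^+ m.+1).

Definition dyadic_passage (L : R) : set Omega :=
  \bigcup_m passage P n B mu c (dyadic_time m) L (2 ^ m.+1).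

(** A path may reach [M] at a non-dyadic time only, so all levels slightly below [M] are required on
    the grids instead. The countable form makes the event measurable. *)
Definition first_passage (M : R) : set Omega :=
  \bigcap_k dyadic_passage (M - k.+1%:R^-1).

Lemma measurable_dyadic_passage L : measurable (dyadic_passage L).
Proof. by apply: bigcup_measurable => m _; exact: measurable_passage. Qed.

Lemma measurable_first_passage M : measurable (first_passage M).
Proof. by apply: bigcapT_measurable => k; exact: measurable_dyadic_passage. Qed.

Lemma dyadic_time_end m : dyadic_time m (2 ^ m.+1) = u.
Proof. by rewrite /dyadic_time natrX mulrCA divff ?mulr1// expf_neq0. Qed.

Lemma dyadic_time_half m : dyadic_time m (2 ^ m) = u / 2.
Proof. by rewrite /dyadic_time natrX exprS; field; rewrite expf_neq0. Qed.

Lemma passage_dyadicS L m :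
  passage P n B mu c (dyadic_time m) L (2 ^ m.+1) `<=`
  passage P n B mu c (dyadic_time m.+1) L (2 ^ m.+2).
Proof.
move=> w [k /= km Lw]; exists (2 * k)%N => /=.
  by rewrite ltnS expnS leq_mul2l/= -ltnS.
rewrite (_ : dyadic_time _ _ = dyadic_time m k)//.
by rewrite /dyadic_time natrM [in LHS]exprS; field; rewrite expf_neq0.
Qed.

Lemma integral_dyadic_passage L :
  mu * (u / 2) * fine (P [set w | L <= X (u / 2) w]) <=
  \int[P]_(w in dyadic_passage L) (X u w - L).
Proof.
have sub a b : (a <= b)%N -> passage P n B mu c (dyadic_time a) L (2 ^ a.+1) `<=`
    passage P n B mu c (dyadic_time b) L (2 ^ b.+1).
  move=> /subnK <-; elim: (b - a)%N => // k IH.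
  exact: subset_trans IH (passage_dyadicS _ _).
apply: (@ge_Rintegral_sets _ _ _ P (fun w => X u w - L)
  (fun m => passage P n B mu c (dyadic_time m) L (2 ^ m.+1)) _ _ (fun=> 0)).
- by apply: integrable_drifted_sub => //; exact/ltW.
- by move=> m; exact: measurable_passage.
- exact: measurable_dyadic_passage.
- move=> w; have [[m _ Fm]|nF] := pselect (dyadic_passage L w).
    near=> k; split => // _; first by exists m.
    by apply: sub Fm; near: k; exact: nbhs_infty_ge.
  by apply: nearW => k; split => // Fk; exfalso; apply: nF; exists k.
- exact: cvg_cst.
- move=> m; rewrite subr0.
  have t0 : dyadic_time m 0 = 0 by rewrite /dyadic_time mul0r.
  have inc k : dyadic_time m k < dyadic_time m k.+1.
    by rewrite /dyadic_time ltr_pM2r ?ltr_nat// divr_gt0// exprn_gt0.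
  (* Taking [l] at the midpoint gives the same lower bound for every grid, so it survives the
     refinement. *)
  have := integral_drifted_passage P n B hB indB mu c mu_ge0 _ t0 inc L
    (2 ^ m) (2 ^ m.+1).
  rewrite dyadic_time_end dyadic_time_half leq_exp2l// => /(_ (leqnSn m)).
  by rewrite [u - u / 2](_ : _ = u / 2)//; field.
Unshelve. all: end_near. Qed.

Lemma integral_first_passage M :
  mu * (u / 2) * fine (P [set w | M <= X (u / 2) w]) <=
  \int[P]_(w in first_passage M) (X u w - M).
Proof.
have mset L : measurable [set w | L <= X (u / 2) w].
  exact: measurable_drifted_level.
have sub a b : a <= b -> dyadic_passage b `<=` dyadic_passage a.
  move=> ab w [m _ [k km bX]]; exists m => //; exists k => //.
  exact: le_trans ab bX.
apply: (@ge_Rintegral_sets _ _ _ P (fun w => X u w - M)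
  (fun k => dyadic_passage (M - k.+1%:R^-1)) _ _ harmonic).
- by apply: integrable_drifted_sub => //; exact/ltW.
- by move=> k; exact: measurable_dyadic_passage.
- exact: measurable_first_passage.
- move=> w; have [Fw|/existsNP[m /not_implyP[_ nF]]] :=
    pselect (first_passage M w).
    by apply: nearW => k; split => // _; exact: Fw.
  near=> k; split; last by move=> Fw; exact: Fw.
  move=> Fk; exfalso; apply: nF; apply: sub Fk.
  rewrite lerD2l lerN2 lef_pV2 ?posrE// ler_nat ltnS.
  by near: k; exact: nbhs_infty_ge.
- exact: cvg_harmonic.
- move=> k; set L := M - k.+1%:R^-1.
  have LM : L <= M by rewrite lerBlDr lerDl.
  rewrite lerBlDr.
  apply: (@le_trans _ _ (mu * (u / 2) * fine (P [set w | L <= X (u / 2) w]))).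
    rewrite ler_wpM2l ?mulr_ge0 ?divr_ge0 ?(ltW u_gt0)//.
    apply: fine_le; rewrite ?fin_num_measure//.
    apply: le_measure; rewrite ?inE//.
    by move=> w /=; exact: le_trans.
  apply: le_trans (integral_dyadic_passage L) _.
  have mF := measurable_dyadic_passage L.
  have iF K : P.-integrable (dyadic_passage L) (EFin \o (fun w => X u w - K)).
    by apply: integrable_drifted_sub => //; exact/ltW.
  (* Passing from level [L] to [M] costs [k.+1%:R^-1] times a probability, which the harmonic error
     absorbs. *)
  have -> : \int[P]_(w in dyadic_passage L) (X u w - L) =
     \int[P]_(w in dyadic_passage L) ((X u w - M) + k.+1%:R^-1).
    by apply: eq_Rintegral => w _; rewrite /L; ring.
  rewrite RintegralD//; last exact: finite_measure_integrable_cst.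
  rewrite lerD2l Rintegral_cst// ler_piMr//.
  rewrite -[leRHS]/(fine 1%E); apply: fine_le; rewrite ?fin_num_measure//.
  exact: probability_le1.
Unshelve. all: end_near. Qed.

End continuous_passage.

(** * Dyadic approximation and hitting times of a continuous path *)

Lemma dyadic_density (R : realType) (u t e : R) : 0 < u -> 0 <= t <= u -> 0 < e ->
  exists m k, [/\ (k <= 2 ^ m.+1)%N & `|t - dyadic_time u m k| < e].
Proof.
move=> u0 /andP[t0 tu] e0.
have [m hm] : exists m, u / 2 ^+ m.+1 < e.
  (* Here [u / e < m.+1 <= 2 ^ m.+1], so the mesh is below [e]. *)
  pose m := Num.truncn (u / e); exists m.
  rewrite ltr_pdivrMr ?exprn_gt0// -ltr_pdivrMl// mulrC.
  apply: (@lt_le_trans _ _ m.+1%:R); first exact: truncnS_gt.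
  by rewrite -natrX ler_nat ltnW// ltn_expl.
have h0 : 0 < u / 2 ^+ m.+1 by rewrite divr_gt0// exprn_gt0.
set h := u / 2 ^+ m.+1 in hm h0.
exists m, (Num.truncn (t / h)).
have th0 : 0 <= t / h by rewrite divr_ge0// ltW.
have /andP[lo hi] := truncn_itv th0.
split; rewrite /dyadic_time -?/h.
  rewrite -(@ler_nat R) (le_trans lo)// ler_pdivrMr// natrX /h mulrCA divff.
    by rewrite mulr1.
  by rewrite expf_neq0.
rewrite ler_pdivlMr// in lo; rewrite ltr_pdivrMr// in hi.
rewrite ger0_norm ?subr_ge0//.
by move: hi; rewrite -natr1 mulrDl mul1r => hi; lra.
Qed.

Section continuous_path.
Context {R : realType}.
Variable x : R -> R.
Hypothesis x_cont : {within `[0, +oo[, continuous x}.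
Hypothesis x0 : x 0 = 0.
Variable M : R.
Hypothesis M_gt0 : 0 < M.

Let hit : \bar R :=
  ereal_inf [set t%:E | t in [set t : R | 0 < t /\ M <= x t]].

Lemma path_epsilon_delta t e : 0 <= t -> 0 < e ->
  exists2 r, 0 < r & forall s, 0 <= s -> `|t - s| < r -> `|x t - x s| < e.
Proof.
move=> t0 e0; have /subspace_continuousP/(_ t) := x_cont.
rewrite /= in_itv/= t0 => /(_ isT)/cvgrPdist_lt/(_ _ e0).
rewrite near_withinE => -[r /= r0 h]; exists r => // s s0 ts.
by apply: h => //; rewrite /= in_itv/= s0.
Qed.

(** If the path stays below [M] on [[0, u]], continuity at [u] keeps it below a little longer, so
    the infimum exceeds [u]. Time 0 is harmless because [x 0 = 0 < M]. *)
Lemma hitting_leP u : 0 <= u ->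
  (hit <= u%:E)%E <-> exists2 t, 0 <= t <= u & M <= x t.
Proof.
move=> u0; split; last first.
  move=> [t /andP[t0 tu] Mt]; apply: (@le_trans _ _ t%:E);
    last by rewrite lee_fin.
  apply: ereal_inf_lbound; exists t => //; split => //.
  rewrite lt_neqAle t0 andbT; apply/eqP => t0'.
  by move: Mt; rewrite -t0' x0 leNgt M_gt0.
move=> hu; apply: contrapT => /forall2NP nt.
have lt t : 0 <= t -> t <= u -> x t < M.
  move=> t0 tu; have [|] := nt t; first by rewrite t0 tu.
  by move=> /negP; rewrite -ltNge.
have d0 : 0 < M - x u by rewrite subr_gt0 lt.
have [r r0 hr] := path_epsilon_delta u _ u0 d0.
suff : ((u + r)%:E <= hit)%E.
  by move=> /le_trans/(_ hu); rewrite lee_fin leNgt ltrDl r0.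
apply: le_ereal_inf_tmp => _ [t [t0 Mt] <-]; rewrite lee_fin leNgt.
apply/negP => tur; have [tu|ut] := leP t u.
  by move: Mt; rewrite leNgt lt// ltW.
have := hr t (ltW t0); rewrite distrC gtr0_norm ?subr_gt0// ltrBlDl => /(_ tur).
by rewrite distrC => /(le_lt_trans (ler_norm _)); lra.
Qed.

Lemma before_hitting_le u : 0 <= u -> (u%:E <= hit)%E -> x u <= M.
Proof.
rewrite le_eqVlt => /predU1P[<- _|u0 uh]; first by rewrite x0 ltW.
rewrite leNgt; apply/negP => Mu.
have d0 : 0 < x u - M by rewrite subr_gt0.
have [r r0 hr] := path_epsilon_delta u _ (ltW u0) d0.
(* A positive time before [u] and within [r] of it: the path already exceeds [M] there, which
   contradicts that [u] is at most the hitting time. *)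
pose s := Num.max (u / 2) (u - r / 2).
have su : s < u by rewrite /s gt_max; apply/andP; split; lra.
have s0 : 0 < s by rewrite /s lt_max; apply/orP; left; lra.
have sr : u - r / 2 <= s by rewrite /s le_max lexx orbT.
have := hr s (ltW s0); rewrite ger0_norm; last lra.
move=> /(_ ltac:(lra)) /(le_lt_trans (ler_norm _)) xs.
suff : (hit <= s%:E)%E.
  by move=> /(le_trans uh); rewrite lee_fin leNgt su.
by apply/hitting_leP; [exact: ltW|exists s; [rewrite ltW//=|lra]].
Qed.

(** Forward, a dyadic time near [t] nearly attains [M]. Backward, if the maximum over [[0, u]] were
    below [M], the gap would exceed some [k.+1%:R^-1]. *)
Lemma first_passage_pathP u : 0 < u ->
  (exists2 t, 0 <= t <= u & M <= x t) <->
  (forall k : nat, exists m j : nat, [/\ (j <= 2 ^ m.+1)%N &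
     M - k.+1%:R^-1 <= x (dyadic_time u m j)]).
Proof.
move=> u0; split => [[t tu Mt] k|h].
  have /andP[t0 _] := tu.
  have e0 : 0 < k.+1%:R^-1 :> R by rewrite invr_gt0.
  move: (k.+1%:R^-1) e0 => e e0.
  have [r r0 hr] := path_epsilon_delta t _ t0 e0.
  have [m [j [jm tj]]] := dyadic_density _ _ _ _ u0 tu r0.
  exists m, j; split => //.
  have d0 : 0 <= dyadic_time u m j.
    by rewrite mulr_ge0// divr_ge0// ?exprn_ge0// ltW.
  by have /(le_lt_trans (ler_norm _)) := hr _ d0 tj; lra.
have [|c cu hc] := @EVT_max R x 0 u (ltW u0).
  apply: continuous_subspaceW x_cont => t /=; rewrite !in_itv/= => /andP[->] //.
exists c; first by move: cu; rewrite in_itv.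
rewrite leNgt; apply/negP => cM.
have d0 : 0 < M - x c by rewrite subr_gt0.
pose k := Num.truncn (M - x c)^-1.
have [m [j [jm]]] := h k.
have kM : k.+1%:R^-1 < M - x c.
  by rewrite -[ltRHS]invrK ltf_pV2 ?posrE ?invr_gt0//; exact: truncnS_gt.
have := hc (dyadic_time u m j); rewrite in_itv/=.
have -> : 0 <= dyadic_time u m j <= u.
  rewrite /dyadic_time mulr_ge0 ?divr_ge0 ?exprn_ge0 ?(ltW u0)//=.
  rewrite mulrA ler_pdivrMr ?exprn_gt0// mulrC ler_pM2l// -natrX ler_nat//.
by move=> /(_ isT); move: (k.+1%:R^-1) kM => e; lra.
Qed.

End continuous_path.

(** * Joint measurability of a continuous process *)

Lemma measurable_indic_comp (R : realType) d1 d2 (T1 : measurableType d1)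
    (T2 : measurableType d2) (f : T1 -> T2) (A : set T2) :
  measurable_fun setT f -> measurable A ->
  measurable_fun setT (fun x => \1_A (f x) : R).
Proof.
by move=> mf mA; apply: (measurableT_comp _ mf); exact: measurable_indic.
Qed.

Lemma measurable_continuous_process (R : realType) d (T : measurableType d)
    (X : R -> T -> R) :
  (forall s, 0 <= s -> measurable_fun setT (X s)) ->
  (forall w, {within `[0, +oo[, continuous (X ^~ w)}) ->
  measurable_fun setT (fun z : measurableTypeR R * T =>
    \1_(`[(0 : R), +oo[%classic) z.1 * X z.1 z.2).
Proof.
move=> mX cX.
(* The process is frozen at the left end of each cell. The [m.+1 * m.+1] cells of width [m.+1%:R^-1]
   cover [[0, m.+1[], so every [u >= 0] is eventually covered and continuity gives pointwise
   convergence. *)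
pose grid (m j : nat) : R := j%:R / m.+1%:R.
pose f m (z : measurableTypeR R * T) := \sum_(j < m.+1 * m.+1)
  \1_(`[grid m j, grid m j.+1[%classic) z.1 * X (grid m j) z.2.
have grid_ge0 m j : 0 <= grid m j by rewrite divr_ge0.
apply: (@measurable_fun_cvg _ _ _ _ f).
  move=> m; apply: measurable_sum => j; apply: measurable_funM.
    apply: measurable_indic_comp => //; exact: measurable_fst.
  by apply: measurableT_comp; [exact: mX|exact: measurable_snd].
move=> [u w] _ /=.
have [u0|u0] := ltP u 0.
  rewrite indicE memNset ?mul0r; last first.
    by rewrite /= in_itv/= andbT => /(lt_le_trans u0); rewrite ltxx.
  rewrite (_ : f ^~ (u, w) = cst 0); first exact: cvg_cst.
  apply/funext => m; rewrite /f big1//= => j _.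
  rewrite indicE memNset ?mul0r//= in_itv/=.
  move=> /andP[/(le_trans (grid_ge0 _ _)) + _].
  by rewrite leNgt u0.
rewrite indicE mem_set ?mul1r; last by rewrite /= in_itv/= u0.
apply/cvgrPdist_lt => e e0.
have [r r0 hr] := path_epsilon_delta _ (cX w) _ _ u0 e0.
near=> m.
have mu : u < m.+1%:R.
  apply: lt_le_trans (truncnS_gt u) _; rewrite ler_nat ltnS.
  by near: m; exact: nbhs_infty_ge.
have mr : m.+1%:R^-1 < r.
  rewrite -[ltRHS]invrK ltf_pV2 ?posrE ?invr_gt0//.
  apply: lt_le_trans (truncnS_gt _) _; rewrite ler_nat ltnS.
  by near: m; exact: nbhs_infty_ge.
have um0 : 0 <= u * m.+1%:R by rewrite mulr_ge0.
have /andP[lo hi] := truncn_itv um0.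
set j := Num.truncn (u * m.+1%:R) in lo hi.
have jm : (j < m.+1 * m.+1)%N.
  rewrite -(@ltr_nat R) (le_lt_trans lo)// natrM ltr_pM2r//.
rewrite /f (bigD1 (Ordinal jm))//= big1 ?addr0; last first.
  move=> k; rewrite -val_eqE/= => kj; rewrite indicE memNset ?mul0r//=.
  rewrite in_itv/= /grid ler_pdivrMr// ltr_pdivlMr// => /andP[ku uk].
  move/negP: kj; apply; rewrite eqn_leq -!(ltnS k) -(ltnS j).
  by rewrite -!(@ltr_nat R) (le_lt_trans ku hi) (le_lt_trans lo uk).
rewrite indicE mem_set ?mul1r; last first.
  by rewrite /= in_itv/= /grid ler_pdivrMr// ltr_pdivlMr// lo hi.
apply: hr => //; rewrite /grid.
have glo : j%:R / m.+1%:R <= u by rewrite ler_pdivrMr.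
rewrite ger0_norm ?subr_ge0//; apply: le_lt_trans mr.
rewrite lerBlDl -[X in _ + X]mul1r -mulrDl natr1 ler_pdivlMr//; exact: ltW.
Unshelve. all: end_near. Qed.

(* The integral of a non-measurable function is a supremum over the simple
functions below its positive part, minus the same for its negative part; this
is why no measurability is required here.  Hitting times are only equal to a
measurable function outside of a null set. *)
Section negligible_modification.
Context d (T : measurableType d) (R : realType) (mu : {measure set T -> \bar R}).
Variable N : set T.
Hypotheses (mN : measurable N) (N0 : mu N = 0).
Import HBNNSimple.
Local Open Scope ereal_scope.

Lemma ge0_le_integral_off_null (f g : T -> \bar R) :
  (forall x, 0 <= f x) -> (forall x, 0 <= g x) ->
  (forall x, ~ N x -> f x = g x) -> \int[mu]_x f x <= \int[mu]_x g x.
Proof.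
move=> f0 g0 fg; rewrite !ge0_integralTE//.
apply: ge_ereal_sup => _ [h hf <-].
apply: ereal_sup_ubound.
(* Setting [h] to zero on [N] puts it below [g] without changing its integral. *)
exists (proj_nnsfun h (measurableC mN)).
  move=> x /=; rewrite mindicE; have [Nx|Nx] := pselect (N x).
    by rewrite memNset// mulr0.
  by rewrite mem_set// mulr1 -fg//; exact: hf.
rewrite -!integralT_nnsfun; apply: ge0_ae_eq_integral => //.
- exact/measurable_EFinP.
- exact/measurable_EFinP.
- by move=> x _; rewrite lee_fin.
- by move=> x _; rewrite lee_fin.
- exists N; split => // x /=; apply: contra_notP => Nx _.
  by rewrite mindicE mem_set// mulr1.
Qed.

Lemma eq_integral_off_null (f g : T -> \bar R) :
  (forall x, ~ N x -> f x = g x) -> \int[mu]_x f x = \int[mu]_x g x.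
Proof.
move=> fg; rewrite [LHS]integralE [RHS]integralE.
by congr (_ - _); apply/eqP; rewrite eq_le !ge0_le_integral_off_null// => x Nx;
  rewrite ?funeposE ?funenegE fg.
Qed.

End negligible_modification.

(** * Comparison of the delays *)

Section delay_comparison.
Context {R : realType} {d : measure_display} {Omega : measurableType d}.
Variable P : probability Omega R.
Variable X : R -> Omega -> R.
Hypothesis mX : forall s, 0 <= s -> measurable_fun setT (X s).
Hypothesis X_cont : forall w, {within `[0, +oo[, continuous (X ^~ w)}.
Hypothesis X_start : forall w, X 0 w = 0.
Variables (M b T K : R).
Hypotheses (M_gt0 : 0 < M) (b_gt0 : 0 < b) (T_gt0 : 0 < T).
Hypothesis X_moment : forall s, 0 <= s <= b ->
  (\int[P]_w `|(X s w)%:E| <= K%:E)%E.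

Definition reached (s : R) : set Omega :=
  [set w | exists2 t, 0 <= t <= s & M <= X t w].

Hypothesis measurable_reached : forall s, 0 < s -> measurable (reached s).
Hypothesis reached_gain : forall s, 0 < s ->
  0 < \int[P]_(w in reached s) (X s w - M).

Definition hitting (w : Omega) : \bar R :=
  ereal_inf [set t%:E | t in [set t : R | 0 < t /\ M <= X t w]].

Definition capped (w : Omega) : R := fine (Order.min (hitting w) b%:E).

Local Notation lambda := (@lebesgue_measure R).
Local Notation U := (measurableTypeR R).

Lemma hitting_ge0 w : (0 <= hitting w)%E.
Proof. by apply: le_ereal_inf_tmp => _ [t [t0 _] <-]; rewrite lee_fin ltW. Qed.

Lemma cappedE w : (capped w)%:E = Order.min (hitting w) b%:E.
Proof.
rewrite fineK// ge0_fin_numE; first by rewrite gt_min ltry orbT.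
by rewrite le_min hitting_ge0 lee_fin ltW.
Qed.

Lemma capped_ge0 w : 0 <= capped w.
Proof. by rewrite -lee_fin cappedE le_min hitting_ge0 lee_fin ltW. Qed.

Lemma capped_le w : capped w <= b.
Proof. by rewrite -lee_fin cappedE ge_min lexx orbT. Qed.

Lemma capped_hitting w : ((capped w)%:E <= hitting w)%E.
Proof. by rewrite cappedE ge_min lexx. Qed.

(** Before time [b] the cap is not active, so only the hitting time can be at most [u]. *)
Lemma capped_leP u w : 0 <= u < b -> capped w <= u <-> reached u w.
Proof.
move=> /andP[u0 ub].
have := hitting_leP (X ^~ w) (X_cont w) (X_start w) M M_gt0 u u0.
rewrite -/(hitting w) /reached/= => <-.
rewrite -lee_fin cappedE ge_min lee_fin (leNgt b) ub orbF//.
Qed.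

Lemma reached0 w : ~ reached 0 w.
Proof.
move=> [t /andP[t0 t0'] Mt]; have t00 : t = 0 by apply/eqP; rewrite eq_le t0 t0'.
by move: Mt; rewrite t00 X_start leNgt M_gt0.
Qed.

Lemma measurable_capped : measurable_fun setT capped.
Proof.
move=> mT; apply: (measurability _ (RGenOInfty.measurableE R)) => //.
move=> _ [_ [r ->] <-]; rewrite setTI.
rewrite (_ : _ @^-1` _ = ~` [set w | capped w <= r]); last first.
  by apply/seteqP; split => w /=; rewrite in_itv/= andbT ltNge => /negP.
apply: measurableC.
have [rb|br] := ltP r b; last first.
  rewrite (_ : [set w | _] = setT)//; apply/seteqP; split => w //= _.
  exact: le_trans (capped_le w) br.
have [r0|r0] := ltP 0 r.
  rewrite (_ : [set w | _] = reached r); first exact: measurable_reached.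
  by apply/seteqP; split => w /= /capped_leP; apply; rewrite ltW.
rewrite (_ : [set w | _] = set0)//; apply/seteqP; split => w //= wr.
have r00 : r = 0 by apply/eqP; rewrite eq_le r0 (le_trans (capped_ge0 w) wr).
rewrite r00 in wr rb; apply: (reached0 w); apply/capped_leP => //.
by rewrite lexx.
Qed.

(** Negative times are cut off because [X] is controlled on [[0, +oo[] only. *)
Let path (z : U * Omega) : R := \1_(`[(0 : R), +oo[%classic) z.1 * X z.1 z.2.
Let chi_capped (z : U * Omega) : R :=
  \1_[set z : U * Omega | 0 <= z.1 <= capped z.2] z.
Let chi_T (z : U * Omega) : R := \1_[set z : U * Omega | 0 <= z.1 <= T] z.

Let m_path : measurable_fun setT path.
Proof. exact: measurable_continuous_process. Qed.

Let m_region (f : U * Omega -> R) : measurable_fun setT f ->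
  measurable [set z : U * Omega | 0 <= (z.1 : R) <= f z].
Proof.
move=> mf.
have m1 : measurable_fun setT (fun z : U * Omega => z.1 : R).
  exact: measurable_fst.
have := measurable_and (measurable_fun_ler (measurable_cst (0 : R)) m1)
  (measurable_fun_ler m1 mf).
by move=> /(_ measurableT [set true]); rewrite setTI; apply.
Qed.

Let m_chi_capped : measurable_fun setT chi_capped.
Proof.
apply: measurable_indic; apply: (m_region (fun z => capped z.2)).
by apply: measurableT_comp; [exact: measurable_capped|exact: measurable_snd].
Qed.

Let m_chi_T : measurable_fun setT chi_T.
Proof. by apply: measurable_indic; exact: (m_region (cst T)). Qed.

(** By Tonelli the integral of [|h|] is at most that of the constant [C] over [[0, b]]. *)
Lemma integrable_prod_bound (h : U * Omega -> R) (C : R) :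
  measurable_fun setT h ->
  (forall u w, ~ (0 <= u <= b) -> h (u, w) = 0) ->
  (forall u, 0 <= u <= b -> (\int[P]_w `|(h (u, w))%:E| <= C%:E)%E) ->
  (lambda \x P)%E.-integrable setT (EFin \o h).
Proof.
move=> mh h0 hC; apply/integrable12ltyP; first exact/measurable_EFinP.
apply: (@le_lt_trans _ _ (\int[lambda]_(u in `[0%R, b]) C%:E)%E); last first.
  rewrite integral_cst//= lebesgue_measure_itv/= lte_fin b_gt0.
  by rewrite -EFinB -EFinM ltry.
rewrite [leRHS]integral_mkcond; apply: ge0_le_integral => //.
- by move=> u _; apply: integral_ge0.
- apply: (measurable_fun_fubini_tonelli_F (abse \o (EFin \o h))) => //.
    by apply: measurableT_comp => //; exact/measurable_EFinP.
  by move=> z; exact: abse_ge0.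
- have mI : measurable (`[0%R, b]%classic : set U) by exact: measurable_itv.
  exact: ((measurable_restrictT _ mI).1 (measurable_cst _)).
- move=> u _; rewrite patchE; case: ifPn => [/set_mem|/negP].
    by rewrite /= in_itv/=; exact: hC.
  move=> nu; rewrite integral0_eq// => w _ /=; rewrite h0 ?normr0//.
  by move=> ub; apply: nu; rewrite inE/= in_itv.
Qed.

Hypothesis capped_mean : (\int[P]_w (capped w)%:E = T%:E)%E.

Let T_le : T <= b.
Proof.
rewrite -lee_fin -capped_mean -[leRHS]mule1 -(@probability_setT _ _ _ P).
rewrite -integral_cst//; apply: ge0_le_integral => //.
- by move=> w _; rewrite lee_fin capped_ge0.
- apply/measurable_EFinP; exact: measurable_capped.
- by move=> w _; rewrite lee_fin capped_le.
Qed.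

Let chi_cappedE (u : R) w : chi_capped (u, w) = (0 <= u <= capped w)%R%:R.
Proof.
rewrite /chi_capped indicE; congr (_%:R); congr nat_of_bool.
by apply/idP/idP => [/set_mem//|h]; apply/mem_set.
Qed.

Let chi_TE (u : R) w : chi_T (u, w) = (0 <= u <= T)%R%:R.
Proof.
rewrite /chi_T indicE; congr (_%:R); congr nat_of_bool.
by apply/idP/idP => [/set_mem//|h]; apply/mem_set.
Qed.

Let pathE (u : R) w : 0 <= u -> path (u, w) = X u w.
Proof. by move=> u0; rewrite /path/= indicE mem_set ?mul1r//= in_itv/= u0. Qed.

Let chi_01 (f : U * Omega -> R) : (f = chi_capped \/ f = chi_T) ->
  [/\ measurable_fun setT f, forall u w, ~ (0 <= u <= b) -> f (u, w) = 0 &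
   forall z, 0 <= f z <= 1].
Proof.
case=> ->; split => //.
- move=> u w ub; rewrite chi_cappedE; case: (boolP (_ && _)) => //= /andP[u0 uc].
  by exfalso; apply: ub; rewrite u0 (le_trans uc (capped_le w)).
- by move=> [u w]; rewrite chi_cappedE ler0n lern1 leq_b1.
- move=> u w ub; rewrite chi_TE; case: (boolP (_ && _)) => //= /andP[u0 uc].
  by exfalso; apply: ub; rewrite u0 (le_trans uc T_le).
- by move=> [u w]; rewrite chi_TE ler0n lern1 leq_b1.
Qed.

Let integrable_chi f : (f = chi_capped \/ f = chi_T) ->
  (lambda \x P)%E.-integrable setT (EFin \o f).
Proof.
move=> /chi_01[mf f0 f01]; apply: (integrable_prod_bound f 1) => // u _.
apply: (@le_trans _ _ (\int[P]_w (cst 1%E w))%E); last first.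
  by rewrite integral_cst//= probability_setT mule1.
apply: ge0_le_integral => //.
- apply: measurableT_comp => //; apply/measurable_EFinP.
  exact: (measurableT_comp mf (measurable_pair1 _)).
- by move=> w _; have /andP[? ?] := f01 (u, w); rewrite /= lee_fin ger0_norm.
Qed.

Let integrable_chi_path f : (f = chi_capped \/ f = chi_T) ->
  (lambda \x P)%E.-integrable setT (EFin \o (fun z => f z * path z)).
Proof.
move=> /chi_01[mf f0 f01]; apply: (integrable_prod_bound _ K).
- exact: measurable_funM.
- by move=> u w ub; rewrite f0 ?mul0r.
- move=> u ub; have /andP[u0 _] := ub; apply: le_trans (X_moment u ub).
  have mXu : measurable_fun setT (X u) by exact: mX.
  apply: ge0_le_integral => //.
  + apply: measurableT_comp => //; apply/measurable_EFinP.
    apply: (measurableT_comp (measurable_funM mf m_path)).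
    exact: measurable_pair1.
  + by apply: measurableT_comp => //; exact/measurable_EFinP.
  + move=> w _; rewrite /= lee_fin pathE// normrM ler_piMl//.
    by have /andP[? ?] := f01 (u, w); rewrite ger0_norm.
Qed.

Let prod_chi_path (f : U * Omega -> R) (tau : Omega -> R) :
  (f = chi_capped \/ f = chi_T) ->
  (forall (u : R) w, f (u, w) = (0 <= u <= tau w)%R%:R) ->
  (\int[lambda \x P]_z (f z * path z)%:E =
   \int[P]_w \int[lambda]_(u in `[0%R, tau w]) (X u w)%:E)%E.
Proof.
move=> fE ftau.
rewrite -(integral21_prod_meas1 (integrable_chi_path f fE)).
apply: eq_integral => w _; rewrite [RHS]integral_mkcond.
apply: eq_integral => u _; rewrite patchE /= ftau.
case: ifPn => [/set_mem|/negP nu].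
  rewrite /= in_itv/= => /[dup] /andP[u0 _] ->.
  by rewrite pathE// mul1r.
case: (boolP (_ && _)) => [h|_]; last by rewrite mul0r.
by exfalso; apply: nu; rewrite inE/= in_itv.
Qed.

Let prod_chi (f : U * Omega -> R) (tau : Omega -> R) :
  (f = chi_capped \/ f = chi_T) -> (forall w, 0 <= tau w) ->
  (forall (u : R) w, f (u, w) = (0 <= u <= tau w)%R%:R) ->
  (\int[lambda \x P]_z (f z)%:E = \int[P]_w (tau w)%:E)%E.
Proof.
move=> fE tau0 ftau.
rewrite -(integral21_prod_meas1 (integrable_chi f fE)).
apply: eq_integral => w _.
rewrite (_ : fubini_G _ _ w =
    (\int[lambda]_u ((\1_(`[(0 : R), tau w]%classic) u)%:E : \bar R))%E);
    last first.
  apply: eq_integral => u _; rewrite /= ftau indicE; congr (_%:R%:E).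
  congr nat_of_bool.
  by apply/idP/idP => [h|/set_mem]; rewrite ?inE/= in_itv.
rewrite integral_indic//= setIT.
rewrite lebesgue_measure_itv/= lte_fin; case: ltP => [_|t0].
  by rewrite -EFinB subr0.
by congr (_%:E); apply/eqP; rewrite eq_le tau0 t0.
Qed.

Let gain (z : U * Omega) : R := (chi_T z - chi_capped z) * (path z - M).

Let integrable_gain : (lambda \x P)%E.-integrable setT (EFin \o gain).
Proof.
have iT := integrable_chi_path _ (or_intror (erefl chi_T)).
have iC := integrable_chi_path _ (or_introl (erefl chi_capped)).
have jT := integrable_chi _ (or_intror (erefl chi_T)).
have jC := integrable_chi _ (or_introl (erefl chi_capped)).
apply: (eq_integrable measurableT (((EFin \o (fun z => chi_T z * path z)%R) \-
  (EFin \o (fun z => chi_capped z * path z)%R)) \-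
  (fun z => M%:E * (((EFin \o chi_T) \- (EFin \o chi_capped)) z)))%E).
  move=> z _ /=; rewrite -!EFinB; congr (_%:E); rewrite /gain; ring.
apply: integrableB => //; first exact: integrableB.
by apply: integrableZl => //; exact: integrableB.
Qed.

(** Both indicators have integral [T] over the product space, one of them by [capped_mean], so the
    terms with [M] cancel. *)
Let integral_gain :
  (\int[lambda \x P]_z (gain z)%:E =
   \int[P]_w \int[lambda]_(u in `[0%R, T]) (X u w)%:E -
   \int[P]_w \int[lambda]_(u in `[0%R, capped w]) (X u w)%:E)%E.
Proof.
have iT := integrable_chi_path _ (or_intror (erefl chi_T)).
have iC := integrable_chi_path _ (or_introl (erefl chi_capped)).
have jT := integrable_chi _ (or_intror (erefl chi_T)).
have jC := integrable_chi _ (or_introl (erefl chi_capped)).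
rewrite -(prod_chi_path _ (cst T) (or_intror (erefl chi_T)))//.
rewrite -(prod_chi_path _ capped (or_introl (erefl chi_capped)))//.
have eT : (\int[lambda \x P]_z (chi_T z)%:E = T%:E)%E.
  rewrite (prod_chi _ (cst T) (or_intror (erefl chi_T)) (fun=> ltW T_gt0) chi_TE).
  rewrite (@integral_cst _ _ _ P setT measurableT T%:E)/=.
  by rewrite probability_setT mule1.
have eC : (\int[lambda \x P]_z (chi_capped z)%:E = T%:E)%E.
  rewrite (prod_chi _ capped (or_introl (erefl chi_capped)))//.
  exact: capped_ge0.
transitivity (\int[lambda \x P]_z ((((chi_T z * path z)%:E -
  (chi_capped z * path z)%:E) -
  (M%:E * ((chi_T z)%:E - (chi_capped z)%:E)))))%E.
  apply: eq_integral => z _; rewrite -!EFinB; congr (_%:E).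
  by rewrite /gain; ring.
rewrite integralB//; last 2 first.
- exact: integrableB.
- by apply: integrableZl => //; exact: integrableB.
rewrite integralB// integralZl//; last exact: integrableB.
by rewrite integralB// eT eC subee// mule0 sube0.
Qed.

Let integral_gain_gt0 : (0 < \int[lambda \x P]_z (gain z)%:E)%E.
Proof.
rewrite -(integral12_prod_meas1 integrable_gain).
set F := fubini_F P (EFin \o gain).
have FE (u : R) : F u = (\int[P]_w (gain (u, w))%:E)%E by [].
have F_gt0 (u : R) : 0 < u <= T -> (0 < F u)%E.
  move=> /andP[u0 uT]; rewrite FE.
  have E : (\int[P]_w (gain (u, w))%:E =
      \int[P]_(w in reached u) (X u w - M)%:E)%E.
    rewrite [RHS]integral_mkcond; apply: eq_integral => w _.
    rewrite patchE /gain chi_TE chi_cappedE pathE ?(ltW u0)// uT/=.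
    case: ifPn => [/set_mem ru|/negP nru].
      have hu : (hitting w <= u%:E)%E.
        apply/(hitting_leP (X ^~ w) (X_cont w) (X_start w) M M_gt0) => //.
        exact: ltW.
      (* The level is reached by time [u] although the cycle has not ended before [u]: it is reached
         exactly at [u], where [X u w = M], and both integrands vanish. *)
      have [uc|_] := boolP (u <= capped w); last by rewrite subr0 mul1r.
      rewrite subrr mul0r; congr (_%:E); apply/esym/eqP; rewrite subr_eq0 eq_le.
      have uh : (u%:E <= hitting w)%E.
        by apply: le_trans (capped_hitting w); rewrite lee_fin.
      have -> : X u w <= M.
        exact: (before_hitting_le (X ^~ w) (X_cont w) (X_start w) M M_gt0 u
          (ltW u0) uh).
      case: ru => t /andP[t0 tu] Mt.
      have th : (hitting w <= t%:E)%E.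
        apply/(hitting_leP (X ^~ w) (X_cont w) (X_start w) M M_gt0) => //.
        by exists t => //; rewrite t0 lexx.
      have := le_trans uh th; rewrite lee_fin => ut.
      by rewrite (_ : u = t)//; apply/eqP; rewrite eq_le ut tu.
    have [_|cu] := boolP (u <= capped w); first by rewrite subrr mul0r.
    exfalso; apply: nru; rewrite inE.
    rewrite -ltNge in cu.
    (* The cycle ends before [u <= T <= b], hence by reaching the level and not by the cap. *)
    have cb : capped w < b by apply: lt_le_trans cu (le_trans uT T_le).
    have cc : 0 <= capped w < b by rewrite capped_ge0.
    have [+ _] := capped_leP _ w cc; move=> /(_ (lexx _)) [t /andP[t0 tc] Mt].
    by exists t => //; rewrite t0 (le_trans tc (ltW cu)).
  rewrite E; have := reached_gain u u0; rewrite /Rintegral.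
  (* [fine] sends the infinities to 0, so a positive real integral comes from a positive extended
     one. *)
  set I := integral _ _ _; by case: I => [r| |] /=; rewrite ?lte_fin ?ltxx.
have F_ge0 (u : R) : (0 <= F u)%E.
  have [u0|u0] := ltP 0 u; last first.
    rewrite FE integral0_eq// => w _; congr (_%:E).
    have [u00|un] := eqVneq u 0.
      rewrite /gain u00 chi_TE chi_cappedE pathE// lexx (ltW T_gt0) capped_ge0.
      by rewrite subrr mul0r.
    have nu : (0 <= u) = false by apply/negbTE; rewrite -ltNge lt_neqAle un u0.
    by rewrite /gain chi_TE chi_cappedE nu/= subrr mul0r.
  have [uT|Tu] := leP u T; first by apply/ltW/F_gt0; rewrite u0.
  rewrite FE; apply: integral_ge0 => w _; rewrite lee_fin /gain.
  rewrite chi_TE chi_cappedE pathE ?(ltW u0)// (leNgt u T) Tu/= sub0r.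
  have [uc|_] := boolP (u <= capped w); last by rewrite oppr0 mul0r.
  rewrite mulN1r oppr_ge0 subr_le0.
  apply: (before_hitting_le (X ^~ w) (X_cont w) (X_start w) M M_gt0 u (ltW u0)).
  by apply: le_trans (capped_hitting w); rewrite lee_fin.
rewrite lt0e integral_ge0 ?andbT//; apply/eqP => n0.
have mF : measurable_fun setT F by exact: measurable_fubini_F integrable_gain.
(* A zero integral would make the nonnegative [F] vanish almost everywhere, yet it is positive on
   []0, T]]. *)
have : (\int[lambda]_u `|F u| = 0)%E.
  by rewrite -[RHS]n0; apply: eq_integral => u _; rewrite gee0_abs.
move/ae_eq_integral_abs => /(_ measurableT mF) [N [mN N0 sub]].
have : (lambda `]0%R, T] <= lambda N)%E.
  apply: le_measure; rewrite ?inE//.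
  move=> u; rewrite /= in_itv/= => uT; apply: sub => /= /(_ I).
  by move=> Fu0; have := F_gt0 _ uT; rewrite Fu0 ltxx.
rewrite N0 lebesgue_measure_itv/= lte_fin T_gt0 -EFinB lee_fin subr0.
by rewrite leNgt T_gt0.
Qed.

Lemma capped_delay_lt :
  (\int[P]_w \int[lambda]_(u in `[0%R, capped w]) (X u w)%:E <
   \int[P]_w \int[lambda]_(u in `[0%R, T]) (X u w)%:E)%E.
Proof.
have fC : (\int[P]_w \int[lambda]_(u in `[0%R, capped w]) (X u w)%:E)%E
    \is a fin_num.
  rewrite -(prod_chi_path _ capped (or_introl (erefl chi_capped)))//.
  apply: integrable_fin_num => //.
  exact: (integrable_chi_path _ (or_introl (erefl chi_capped))).
by have := integral_gain_gt0; rewrite integral_gain sube_gt0.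
Qed.

End delay_comparison.

(** * Every level is exceeded with positive probability *)

Section drifted_level.
Context {R : realType} {d : measure_display} {Omega : measurableType d}.
Variable P : probability Omega R.
Variables (n : nat) (B : 'I_n -> R -> {RV P >-> R}).
Hypothesis hB : forall i, standard_brownian_motion (B i).
Hypothesis indB : independent_processes B.
Variables (mu : R) (c : 'I_n -> R).
Hypothesis mu_ge0 : 0 <= mu.
Hypothesis c_gt0 : forall i, 0 < c i.
Hypothesis n_gt0 : (0 < n)%N.

(** It suffices that each Brownian increment over [[0, s]] is at least [L]: the term of [i0] alone
    then gives [|M|] and the others are nonnegative. By independence this event has a product of
    positive normal tails as probability. *)
Lemma drifted_level_gt0 (s M : R) : 0 < s ->
  (0 < P [set w | (M <= drifted P n B mu c s w)%R])%E.
Proof.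
move=> s0.
pose i0 : 'I_n := Ordinal n_gt0.
pose L := `|M| / c i0.
have L0 : 0 <= L by rewrite divr_ge0// ltW.
(* This grid presents [B i s - B i 0] as the increment of index 0. *)
pose t (k : nat) : R := k%:R * s.
have t0 : 0 <= t 0%N by rewrite /t mul0r.
have nd_t : nondecreasing_seq t.
  by move=> a b ab; rewrite /t ler_pM2r// ler_nat.
have incE i : increment P n B t i 0 = B i s \- B i 0.
  by rewrite /increment /t mul1r mul0r.
pose A i : set Omega := increment P n B t i 0 @^-1` `[L, +oo[%classic.
have mA i : measurable (A i).
  by rewrite -[A i]setTI; apply: measurable_increment.
have sA i : process_sigma_algebra (B i) (A i).
  exact: (process_sigma_algebra_increment P n B t t0 nd_t).
apply: (@lt_le_trans _ _ (P (\bigcap_(i in [set` [set: 'I_n]%SET]) A i))).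
  rewrite indB//; elim/big_ind: _ => //.
    by move=> x y x0 y0; rewrite mule_gt0.
  move=> i _; rewrite /A incE (brownian_increment_law P (B i) (hB i))//.
  by apply: normal_prob_ge_gt0; rewrite sqrtr_gt0 subr0.
apply: le_measure; rewrite ?inE.
- by apply: fin_bigcap_measurable.
- exact: measurable_drifted_level.
move=> w hw.
have hL i : L <= B i s w - B i 0 w.
  by have := hw i; rewrite /A incE /= inE in_itv/= andbT; apply.
rewrite /= /drifted (le_trans (ler_norm M))//.
have -> : `|M| = 0 + (c i0 * L + 0).
  by rewrite /L add0r addr0 mulrCA divff ?mulr1// gt_eqF.
rewrite lerD ?mulr_ge0 ?(ltW s0)// (bigD1 i0)//= lerD//.
  by rewrite ler_pM2l.
by apply: sumr_ge0 => i _; rewrite mulr_ge0 ?(ltW (c_gt0 i))// (le_trans L0).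
Qed.

End drifted_level.

(** * Changes on null sets and application to the weighted Brownian demand *)

Lemma eq_Rintegral_off_null (R : realType) d (T : measurableType d)
    (mu : {measure set T -> \bar R}) (N A A' : set T) (f f' : T -> R) :
  measurable N -> mu N = 0%E ->
  (forall x, ~ N x -> A x <-> A' x) -> (forall x, ~ N x -> f x = f' x) ->
  \int[mu]_(x in A) f x = \int[mu]_(x in A') f' x.
Proof.
move=> mN N0 AA ff; rewrite /Rintegral; congr fine.
rewrite integral_mkcond [RHS]integral_mkcond.
apply: (eq_integral_off_null _ _ _ _ N) => // x nx; rewrite !patchE.
have [xA|xA] := boolP (x \in A).
  by rewrite mem_set ?ff//; apply/AA => //; exact/set_mem.
by rewrite memNset// => /(AA x nx)/mem_set; exact/negP.
Qed.

Lemma brownian_common_null_set (R : realType) d (Omega : measurableType d)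
    (P : probability Omega R) (n : nat) (B : 'I_n -> R -> {RV P >-> R}) :
  (forall i, standard_brownian_motion (B i)) ->
  exists N, [/\ measurable N, P N = 0%E &
    forall w, ~ N w -> forall i, B i 0 w = 0 /\
      {within `[0, +oo[, continuous (fun t => B i t w)}].
Proof.
move=> hB.
have : {ae P, forall w, forall i, B i 0 w = 0 /\
    {within `[0, +oo[, continuous (fun t => B i t w)}}.
  apply: filter_forall => i; have [B0 _ _ Bc] := hB i.
  exact: filterS2 B0 Bc.
move=> [N [mN N0 sub]]; exists N; split => // w nw.
by apply: contrapT => h; apply: nw; apply: sub.
Qed.

Lemma within_continuous_drifted (R : realType) d (Omega : measurableType d)
    (P : probability Omega R) (n : nat) (B : 'I_n -> R -> {RV P >-> R})
    (mu : R) (c : 'I_n -> R) (A : set R) (w : Omega) :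
  (forall i, {within A, continuous (fun t => B i t w)}) ->
  {within A, continuous (fun s => drifted P n B mu c s w)}.
Proof.
move=> cB s; apply: cvgD.
  apply: cvgM; first exact: cvg_cst.
  exact: (@continuous_subspaceT _ _ A id (fun x => cvg_id)).
apply: cvg_big => [|i _]; first exact: add_continuous.
apply: cvgM; first exact: cvg_cst.
by apply: cvgB; [exact: cB|exact: cvg_cst].
Qed.

(** Off [Z] the paths are continuous, hence integrable on the compact cycle, and the finite sum
    passes under the time integral. *)
Lemma delay_cost_ae (R : realType) d (Omega : measurableType d)
    (P : probability Omega R) (n : nat) (N : 'I_n -> R -> Omega -> R)
    (omega : 'I_n -> R) (tau : Omega -> \bar R) (sigma : Omega -> R)
    (X : R -> Omega -> R) (Z : set Omega) :
  measurable Z -> P Z = 0%E ->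
  (forall w, ~ Z w -> forall i,
    {within `[0, +oo[, continuous (fun t => N i t w)}) ->
  (forall w, ~ Z w -> tau w = (sigma w)%:E) ->
  (forall w s, ~ Z w -> X s w = \sum_(i < n) omega i * N i s w) ->
  (\int[P]_w (\sum_(i < n)
      \int[lebesgue_measure]_(u in [set u : R | (0 <= u)%R /\ u%:E <= tau w])
        (omega i * N i u w)%:E) =
   \int[P]_w \int[lebesgue_measure]_(u in `[0%R, sigma w]) (X u w)%:E)%E.
Proof.
move=> mZ Z0 cN tauE XE; apply: (eq_integral_off_null _ _ _ _ Z) => // w nZ.
rewrite tauE//.
have -> : [set u : R | 0 <= u /\ (u%:E <= (sigma w)%:E)%E] =
    `[0, sigma w]%classic.
  by apply/seteqP; split => u; rewrite /= in_itv/= lee_fin => /andP.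
rewrite -integral_sum//=.
  apply: eq_integral => u _; rewrite XE// sumEFin//.
move=> i; apply: continuous_compact_integrable; first exact: segment_compact.
move=> s; apply: cvgM; first exact: cvg_cst.
apply: (continuous_subspaceW _ (cN w nZ i)).
by move=> t /=; rewrite !in_itv/= => /andP[->].
Qed.

Theorem theorem25 (R : realType) (d : measure_display)
    (Omega : measurableType d) (P : probability Omega R)
    (n : nat) (B : 'I_n -> R -> {RV P >-> R})
    (D sigma omega : 'I_n -> R) (M_H T_H T : R) :
  (1 <= n)%N ->
  (forall i, standard_brownian_motion (B i)) ->
  independent_processes B ->
  (forall i, 0 < D i) ->
  (forall i, 0 < sigma i) ->
  (forall i, 0 < omega i) ->
  0 < M_H -> 0 < T_H -> 0 < T ->
  (\int[P]_w irhp_cycle omega (cumulative_demand D sigma B) M_H T_H w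
    = T%:E)%E ->
  (AWDR P omega (cumulative_demand D sigma B)
      (irhp_cycle omega (cumulative_demand D sigma B) M_H T_H)
    < AWDR P omega (cumulative_demand D sigma B) (tp_cycle T))%E.
Proof.
move=> n_gt0 hB indB D_gt0 sigma_gt0 omega_gt0 M_gt0 b_gt0 T_gt0 mean_cycle.
have [Z [mZ Z0 good]] := brownian_common_null_set _ _ _ P n B hB.
pose mu := \sum_(i < n) omega i * D i.
pose c i := omega i * sigma i.
have mu_gt0 : 0 < mu.
  rewrite /mu (bigD1 (Ordinal n_gt0))//= ltr_wpDr ?mulr_gt0//.
  by apply: sumr_ge0 => i _; rewrite ltW// mulr_gt0.
have mu_ge0 := ltW mu_gt0.
have c_gt0 i : 0 < c i by rewrite mulr_gt0.
pose Y := drifted P n B mu c.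
(* Outside of the null set [Z] this is the weighted demand; on [Z] it is [0], so
that every path is continuous, starts at [0] and never reaches [M_H] there. *)
pose X s w := Y s w * \1_(~` Z) w.
have XZ w s : Z w -> X s w = 0.
  by move=> Zw; rewrite /X indicE memNset ?mulr0//; apply.
have XY w s : ~ Z w -> X s w = Y s w.
  by move=> Zw; rewrite /X indicE mem_set ?mulr1.
have XN w s : ~ Z w ->
    X s w = \sum_(i < n) omega i * cumulative_demand D sigma B i s w.
  move=> Zw; rewrite XY// /Y /drifted /mu mulr_suml -big_split/=.
  apply: eq_bigr => i _; have [-> _] := good w Zw i.
  by rewrite /cumulative_demand /c; ring.
have mX s : measurable_fun setT (X s).
  apply: measurable_funM; first exact: measurable_drifted.
  by apply: measurable_indic; exact: measurableC.
have X_cont w : {within `[0, +oo[, continuous (X ^~ w)}.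
  have [Zw|Zw] := pselect (Z w).
    rewrite (_ : X ^~ w = cst 0); first by move=> s; exact: cvg_cst.
    by apply/funext => s; exact: XZ.
  rewrite (_ : X ^~ w = Y ^~ w); last by apply/funext => s; exact: XY.
  by apply: within_continuous_drifted => i; have [] := good w Zw i.
have X_start w : X 0 w = 0.
  rewrite /X /Y /drifted mulr0 add0r big1 ?mul0r// => i _.
  by rewrite subrr mulr0.
(* The bound of [drifted_moment] at the last time [T_H], where it is largest. *)
pose K := mu * T_H + \sum_(i < n) `|c i| * (Num.sqrt 2 * Num.sqrt T_H).
have X_moment s : 0 <= s <= T_H -> (\int[P]_w `|(X s w)%:E| <= K%:E)%E.
  move=> /andP[s0 sT]; rewrite (eq_integral_off_null _ _ _ _ Z mZ Z0 _
    (fun w => `|(Y s w)%:E|)%E); last by move=> w nZ; rewrite XY.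
  apply: le_trans (drifted_moment P n B hB mu c mu_ge0 s s0) _.
  rewrite lee_fin lerD ?ler_wpM2l//; apply: ler_sum => i _.
  by rewrite !ler_wpM2l ?sqrtr_ge0// ler_wsqrtr.
have reachedE s w : 0 < s -> ~ Z w ->
    first_passage P n B mu c s M_H w <-> reached X M_H s w.
  move=> s0 nZ.
  apply: iff_trans (iff_sym (first_passage_pathP _ (X_cont w) M_H s s0)).
  split => [h k|h k _].
    have [m _ [j /= jm Mj]] := h k I.
    by exists m, j; split; [rewrite -ltnS|rewrite XY].
  have [m [j [jm Mj]]] := h k; exists m => //; exists j => //=.
  by rewrite XY in Mj.
have mreached s : 0 < s -> measurable (reached X M_H s).
  move=> s0.
  rewrite (_ : reached X M_H s = first_passage P n B mu c s M_H `&` ~` Z).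
    by apply: measurableI; [exact: measurable_first_passage|exact: measurableC].
  apply/seteqP; split => w; last by move=> [h nZ]; exact/reachedE.
  have [Zw|nZ] := pselect (Z w).
    by move=> [t _]; rewrite XZ// leNgt M_gt0.
  by move=> h; split => //; exact/reachedE.
have gain s : 0 < s -> 0 < \int[P]_(w in reached X M_H s) (X s w - M_H).
  move=> s0.
  rewrite -(eq_Rintegral_off_null _ _ _ _ Z (first_passage P n B mu c s M_H) _
    (fun w => Y s w - M_H) _ mZ Z0); last 2 first.
  - by move=> w nZ; exact: reachedE.
  - by move=> w nZ; rewrite XY.
  (* Strictness comes from here: the drift is positive and the level is exceeded at time [s / 2]
     with positive probability. *)
  apply: lt_le_trans (integral_first_passage P n B hB indB mu c mu_ge0 s s0 M_H).
  rewrite !mulr_gt0//.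
  apply: fine_gt0; rewrite drifted_level_gt0 ?divr_gt0//=.
  by rewrite ltey_eq fin_num_measure// ; exact: measurable_drifted_level.
have cappedE' w : ~ Z w ->
    irhp_cycle omega (cumulative_demand D sigma B) M_H T_H w =
    (capped X M_H T_H w)%:E.
  move=> nZ; rewrite cappedE// /irhp_cycle; congr Order.min.
  rewrite /hitting_time /hitting; congr (ereal_inf (_ @` _)).
  by apply/seteqP; split => t /=; rewrite XN.
have capped_mean : (\int[P]_w (capped X M_H T_H w)%:E = T%:E)%E.
  rewrite -mean_cycle; apply/esym.
  exact: (eq_integral_off_null _ _ _ _ Z mZ Z0).
have lt := capped_delay_lt P X (fun s _ => mX s) X_cont X_start M_H T_H T K
  M_gt0 b_gt0 T_gt0 X_moment mreached gain capped_mean.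
have cN w : ~ Z w -> forall i,
    {within `[0, +oo[, continuous (fun t => cumulative_demand D sigma B i t w)}.
  move=> nZ i s; apply: cvgD; apply: cvgM; try exact: cvg_cst.
    exact: (@continuous_subspaceT _ _ _ id (fun x => cvg_id)).
  by have [_ ] := good w nZ i; apply.
(* Both rates have denominator [T], so comparing the numerators is enough. *)
rewrite /AWDR mean_cycle.
rewrite (delay_cost_ae _ _ _ _ _ _ _ _ _ X Z mZ Z0 cN cappedE' XN).
rewrite (delay_cost_ae _ _ _ _ _ _ _ (tp_cycle T) (cst T) X Z mZ Z0 cN _ XN)//.
have -> : (\int[P]_w tp_cycle T w = T%:E)%E.
  by rewrite /tp_cycle integral_cst//= probability_setT mule1.
rewrite inver gt_eqF// lte_pmul2r// lte_fin invr_gt0//.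
Qed.
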